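(* Let $n\ge 2$ and let $\Gamma\subset U(n)$ be an admissible subgroup. For every integer $N\ge N(\Gamma)^2-2N(\Gamma)+2$, there exists a non-constant smooth CR mapping $f:S^{2n-1}/\Gamma\to S^{2N-1}$ (that is, a non-constant smooth CR mapping $f:S^{2n-1}\to S^{2N-1}$ with $f\circ\gamma=f$ for all $\gamma\in\Gamma$) for which $N$ is the minimal embedding dimension.
   Context: $S^{2n-1}$ denotes the unit sphere in $\mathbb{C}^n$, and $U(n)$ the unitary group acting on $\mathbb{C}^n$. A CR mapping $f:S^{2n-1}/\Gamma\to S^{2N-1}$ means a CR mapping $f:S^{2n-1}\to S^{2N-1}\subset\mathbb{C}^N$ that is $\Gamma$-invariant, i.e. $f\circ\gamma=f$ for all $\gamma\in\Gamma$. Admissible subgroups: a finite subgroup $\Gamma$ of $U(n)$ is called admissible if it is equivalent (conjugate in $U(n)$) to one of the following cyclic groups: (i) $\langle \omega I_n\rangle$, where $\omega$ is a primitive $p$-th root of unity; (ii) $\langle \omega I_k\oplus\omega^2 I_{n-k}\rangle$, where $\omega$ is a primitive $p$-th root of unity with $p$ odd; (iii) $\langle \omega I_j\oplus\omega^2 I_k\oplus\omega^4 I_{n-j-k}\rangle$, where $\omega$ is a primitive 7th root of unity. (All block sizes are positive; $I_m$ is the $m\times m$ identity matrix, and $\oplus$ denotes the block-diagonal sum.) The number $N(\Gamma)$: define the real-valued $\Gamma$-invariant polynomial $$\Phi_\Gamma(z,\bar z)=1-\prod_{\gamma\in\Gamma}\bigl(1-\langle\gamma z,z\rangle\bigr)=\sum_{\alpha,\beta}c_{\alpha\beta}z^\alpha\bar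 z^\beta,$$ where $\langle\cdot,\cdot\rangle$ is the standard Hermitian inner product on $\mathbb{C}^n$ and $\alpha,\beta$ are multi-indices. The coefficient matrix $(c_{\alpha\beta})$ is Hermitian. Let $N^+(\Gamma)$ and $N^-(\Gamma)$ be its numbers of positive and negative eigenvalues, counted with multiplicity, and set $N(\Gamma)=N^+(\Gamma)+N^-(\Gamma)$, the rank of $(c_{\alpha\beta})$. Minimal embedding dimension: $N$ is the minimal embedding dimension for $f=(f_1,\dots,f_N):S^{2n-1}\to S^{2N-1}\subset\mathbb{C}^N$ if the components $f_1,\dots,f_N$ are linearly independent over $\mathbb{C}$, equivalently if the image of $f$ is not contained in any proper complex linear subspace of $\mathbb{C}^N$. *)

(* Defs.v *)
From HB Require Import structures.
From mathcomp Require Import all_boot all_order all_algebra finmap.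
(* The notations of mpoly clash with those of MathComp-Analysis. *)
From mathcomp Require Import -(notations) mpoly.
From mathcomp Require Import complex.
From mathcomp Require Import all_classical all_reals all_analysis.

Set Implicit Arguments.
Unset Strict Implicit.
Unset Printing Implicit Defensive.

Import Order.TTheory GRing.Theory Num.Theory.
Import numFieldNormedType.Exports.

Local Open Scope classical_set_scope.
Local Open Scope complex_scope.
Local Open Scope sesquilinear_scope.
Local Open Scope ring_scope.

Definition herm (R : realType) (n : nat) (u v : 'cV[R[i]]_n) : R[i] :=
  \sum_(j < n) u j 0 * Num.conj (v j 0).

Definition sphere (R : realType) (n : nat) : set 'cV[R[i]]_n :=
  [set z | herm z z = 1].

Definition finite_unitary_subgroup (R : realType) (n : nat)
    (Gamma : {fset 'M[R[i]]_n}) : Prop :=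
  [/\ forall g, g \in Gamma -> g \is unitarymx,
      1%:M \in Gamma,
      forall g h, g \in Gamma -> h \in Gamma -> g *m h \in Gamma
    & forall g, g \in Gamma -> invmx g \in Gamma].

Definition gen_scalar (R : realType) (n : nat) (D : 'M[R[i]]_n) : Prop :=
  exists (p : nat) (w : R[i]), p.-primitive_root w /\ D = w%:M.

Definition gen_two_blocks (R : realType) (n : nat) (D : 'M[R[i]]_n) : Prop :=
  exists (p k : nat) (w : R[i]),
    [/\ odd p, p.-primitive_root w, (0 < k < n)%N
      & D = diag_mx (\row_(i < n) if (i < k)%N then w else w ^+ 2)].

Definition gen_three_blocks (R : realType) (n : nat) (D : 'M[R[i]]_n) : Prop :=
  exists (j k : nat) (w : R[i]),
    [/\ 7.-primitive_root w, (0 < j)%N, (0 < k)%N, (j + k < n)%N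
      & D = diag_mx (\row_(i < n) if (i < j)%N then w
                                  else if (i < j + k)%N then w ^+ 2
                                  else w ^+ 4)].

(* The powers D ^+ m with m : nat exhaust the cyclic group generated by D,
   since D has finite order in each of the three cases. *)
Definition admissible (R : realType) (n : nat)
    (Gamma : {fset 'M[R[i]]_n}) : Prop :=
  finite_unitary_subgroup Gamma /\
  exists D : 'M[R[i]]_n,
    [\/ gen_scalar D, gen_two_blocks D | gen_three_blocks D] /\
    exists2 U : 'M[R[i]]_n, U \is unitarymx &
      forall g, g \in Gamma <-> exists m : nat, g = U *m (D ^+ m) *m U^t*.

(* In the 2n indeterminates of the polynomials below, the indeterminate
   'X_(lshift n j) stands for z_j and 'X_(rshift n j) for the conjugate of z_j. *)
Definition herm_poly (R : realType) (n : nat) (g : 'M[R[i]]_n)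
    : mpoly (n + n) R[i] :=
  \sum_(i < n) \sum_(j < n)
    g i j *: (mpolyX R[i] (mnm1 (lshift n j)) * mpolyX R[i] (mnm1 (rshift n i))).

Definition Phi (R : realType) (n : nat) (Gamma : {fset 'M[R[i]]_n})
    : mpoly (n + n) R[i] :=
  1 - \prod_(g <- Gamma) (1 - herm_poly g).

Definition mnm_pair (n : nat) (a b : multinom n) : multinom (n + n) :=
  Multinom [tuple match fintype.split i with inl j => a j | inr j => b j end
           | i < n + n].

(* Rows and columns range over the multi-indices of length at most #|Gamma|;
   Phi has degree at most #|Gamma| in z and in its conjugate, so only zero rows
   and zero columns are left out. *)
Definition coef_mx (R : realType) (n : nat) (Gamma : {fset 'M[R[i]]_n})
    : 'M[R[i]]_(#|{: bmultinom n #|` Gamma|.+1}|) :=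
  \matrix_(i, j)
    mcoeff (mnm_pair (bmnm (enum_val i)) (bmnm (enum_val j))) (Phi Gamma).

Definition eigenvalues (R : realType) (m : nat) (A : 'M[R[i]]_m) : seq R[i] :=
  sval (closed_field_poly_normal (char_poly A)).

(* For x : R[i], 0 < x means that x is real and positive. *)
Definition Npos (R : realType) (n : nat) (Gamma : {fset 'M[R[i]]_n}) : nat :=
  count (fun x => 0 < x) (eigenvalues (coef_mx Gamma)).

Definition Nneg (R : realType) (n : nat) (Gamma : {fset 'M[R[i]]_n}) : nat :=
  count (fun x => x < 0) (eigenvalues (coef_mx Gamma)).

Definition NGamma (R : realType) (n : nat) (Gamma : {fset 'M[R[i]]_n}) : nat :=
  (Npos Gamma + Nneg Gamma)%N.

Fixpoint Ck_on (R : realType) (V : normedModType R) (k : nat) (U : set V)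
    (g : V -> R) : Prop :=
  match k with
  | 0 => forall x, U x -> {for x, continuous g}
  | k'.+1 => (forall x, U x -> differentiable g x) /\
             (forall v : V, Ck_on k' U ('D_v g))
  end.

Definition smooth_on (R : realType) (V : normedModType R) (U : set V)
    (g : V -> R) : Prop :=
  forall k : nat, Ck_on k U g.

(* C^n as a real normed space, z = x + i y being identified with (x, y). *)
Definition realify (R : realType) (n : nat) (z : 'cV[R[i]]_n)
    : 'cV[R]_n * 'cV[R]_n :=
  (map_mx (@complex.Re R) z, map_mx (@complex.Im R) z).

Definition smooth_complex_on (R : realType) (V : normedModType R) (U : set V)
    (F : V -> R[i]) : Prop :=
  smooth_on U (fun x => complex.Re (F x)) /\ smooth_on U (fun x => complex.Im (F x)).

Definition dderiv (R : realType) (V : normedModType R) (F : V -> R[i])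
    (x v : V) : R[i] :=
  'D_v (fun y => complex.Re (F y)) x +i* 'D_v (fun y => complex.Im (F y)) x.

(* A function on the sphere is smooth if it is the restriction of a smooth
   function F on an open neighbourhood. The complex tangent space of the sphere
   at z is {v | <v, z> = 0}, and f is CR if its differential (which on tangent
   vectors does not depend on F) is complex-linear there; these are the
   tangential Cauchy-Riemann equations. *)
Definition smooth_CR_function (R : realType) (n : nat)
    (f : 'cV[R[i]]_n -> R[i]) : Prop :=
  exists (U : set ('cV[R]_n * 'cV[R]_n)) (F : 'cV[R]_n * 'cV[R]_n -> R[i]),
    [/\ open U /\ (forall z, sphere z -> U (realify z)),
        smooth_complex_on U F,
        forall z, sphere z -> F (realify z) = f z
      & forall z v, sphere z -> herm v z = 0 ->
          dderiv F (realify z) (realify ('i%C *: v))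
          = 'i%C * dderiv F (realify z) (realify v)].

(* Only the values of f on the sphere matter, here and below. As f takes values
   in the unit sphere, its differential maps complex tangent spaces to complex
   tangent spaces as soon as each component is CR. *)
Definition smooth_CR_mapping (R : realType) (n N : nat)
    (f : 'cV[R[i]]_n -> 'cV[R[i]]_N) : Prop :=
  (forall z, sphere z -> sphere (f z)) /\
  (forall k : 'I_N, smooth_CR_function (fun z => f z k 0)).

Definition invariant_under (R : realType) (n N : nat)
    (Gamma : {fset 'M[R[i]]_n}) (f : 'cV[R[i]]_n -> 'cV[R[i]]_N) : Prop :=
  forall g z, g \in Gamma -> sphere z -> f (g *m z) = f z.

Definition nonconstant_on_sphere (R : realType) (n N : nat)
    (f : 'cV[R[i]]_n -> 'cV[R[i]]_N) : Prop :=
  exists z w, [/\ sphere z, sphere w & f z <> f w].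

Definition minimal_embedding_dimension (R : realType) (n N : nat)
    (f : 'cV[R[i]]_n -> 'cV[R[i]]_N) : Prop :=
  forall a : 'I_N -> R[i],
    (forall z, sphere z -> \sum_(k < N) a k * f z k 0 = 0) ->
    forall k, a k = 0.

(* Main.v *)
From HB Require Import structures.
Require Import Defs.
From mathcomp Require Import all_boot all_order all_algebra finmap.
From mathcomp Require Import -(notations) mpoly.
From mathcomp Require Import complex.
From mathcomp Require Import all_classical all_reals all_analysis.
From mathcomp Require Import zify ring.

Set Implicit Arguments.
Unset Strict Implicit.
Unset Printing Implicit Defensive.

Import Order.TTheory GRing.Theory Num.Theory.
Import numFieldNormedType.Exports.

Local Open Scope complex_scope.
Local Open Scope sesquilinear_scope.
Local Open Scope ring_scope.

(** Write Phi(z, w) for the polarization of Phi, in which conj w replaces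
    conj z, and d for N(Gamma).

    The starting point is that Phi is a sum of Hermitian squares
    g(z) * conj (g(w)) of polynomials g.  If the blocks of Gamma contribute
    a, b, c, which are themselves such sums, then 1 - Phi is the product over
    the p-th roots of unity t of 1 - a t, 1 - a t - b t^2 or
    1 - a t - b t^2 - c t^4.  The three products are computed exactly, and each
    time Phi is a polynomial in a, b, c with nonnegative integer coefficients:
    a^p in the first case; tr M^p + b^p, with M the companion matrix of
    X^2 - a X - b, in the second ([prod_companion2], where p odd gives the sign
    of b^p); an explicit polynomial in the third ([prod_seventh_roots]).  Sums
    of Hermitian squares are closed under addition and multiplication, whence
    [Phi_herm_sos].

    So the coefficient matrix of Phi is positive semidefinite.  All its nonzero
    eigenvalues are positive, and the spectral theorem writes Phi(z, w) as the
    sum of f_k(z) * conj (f_k(w)) over exactly d linearly independent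
    polynomials f_k ([Phi_lin_indep_sos]).  The map f sends the sphere to the
    sphere because the factor of Phi at the identity of Gamma is 1 - <z, w>; it
    is Gamma-invariant and vanishes at 0 because Phi does, linear independence
    allowing to separate the f_k ([kernel_map_invariant], [kernel_map_at0]).
    Moreover d > 1, as n > 1 ([kernel_map_card_gt1]).

    Now tensor.  In an invariant polynomial map g into a sphere, with m linearly
    independent components, let h be a component of highest degree.  Replacing
    h by the d products h f_k gives a map with m + d - 1 components
    ([full_tensor]); doing this to only a part of h, that is, replacing h by
    3/5 h and the 4/5 h f_k, gives m + d components ([partial_tensor]).  Linear
    independence persists because a nonzero combination of the f_k vanishes at
    0, so has positive degree, and its product with h exceeds every degree in g
    ([top_degree_tensor]).  Starting from f, every N of the form
    d + a (d - 1) + b d is reached.  The numbers a (d - 1) + b d include all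
    integers from (d - 2) (d - 1) on, hence all N >= d^2 - 2 d + 2 are reached.

    Finally, a polynomial that vanishes on the sphere is zero ([eq0_on_sphere]),
    so that independence of the components as polynomials is minimality of the
    embedding dimension; since N > 1, it also prevents the map from being
    constant. *)

(** * Products over roots of unity *)

(** Reversing the polynomials in X^p - 1 = \prod (X - v^m), with v the inverse
    of w. *)
Lemma prod_one_sub_prim_root (F : fieldType) (p : nat) (w : F) :
  p.-primitive_root w ->
  \prod_(m < p) (1 - (w ^+ m)%:P * 'X) = 1 - 'X^p.
Proof.
move=> pw; have p_gt0 := prim_order_gt0 pw.
have w_neq0 m : w ^+ m != 0.
  by rewrite expf_neq0 // (prim_root_eq0 pw) -lt0n.
have pv : p.-primitive_root w^-1.
  have -> : w^-1 = w ^+ p.-1.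
    apply: (mulfI (w_neq0 1)); rewrite expr1 -exprS prednK //.
    by rewrite (prim_expr_order pw) mulfV // -(expr1 w).
  by rewrite (prim_root_exp_coprime _ pw) coprime_sym -{1}(prednK p_gt0) coprimeSn.
have fac : \prod_(m < p) (1 - (w ^+ m)%:P * 'X) =
    (\prod_(m < p) - w ^+ m)%:P * ('X^p - 1).
  rewrite -(factor_Xn_sub_1 pv) big_mkord rmorph_prod -big_split /=.
  apply: eq_bigr => m _; rewrite mulrBr -polyCM exprVn mulNr mulfV // !polyCN.
  by rewrite opprK addrC mulNr.
have := congr1 (horner^~ 0) fac.
rewrite !(hornerM, hornerD, hornerN, hornerC, hornerXn) expr0n.
rewrite eqn0Ngt p_gt0 /= sub0r mulrN1 horner_prod big1 => [c1|m _]; last first.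
  by rewrite !(hornerM, hornerD, hornerN, hornerC, hornerX) mulr0 subr0.
by rewrite fac -[X in X%:P]opprK -c1 polyCN mulN1r opprB.
Qed.

Lemma det_mx2 (A : comNzRingType) (M : 'M[A]_2) :
  \det M = M 0 0 * M 1 1 - M 0 1 * M 1 0.
Proof.
rewrite (expand_det_row _ 0) !big_ord_recl big_ord0 addr0 /cofactor !det_mx11.
rewrite !mxE /= expr0 expr1 mul1r mulN1r mulrN.
by congr (M _ _ * M _ _ - M _ _ * M _ _); apply/val_inj.
Qed.

Lemma trace_mx2 (A : comNzRingType) (M : 'M[A]_2) : \tr M = M 0 0 + M 1 1.
Proof.
rewrite /mxtrace !big_ord_recl big_ord0 addr0.
by congr (M _ _ + M _ _); apply/val_inj.
Qed.

(** The companion matrix of X^2 - a X - b. *)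
Definition companion2 (A : comNzRingType) (a b : A) : 'M[A]_2 :=
  \matrix_(i, j) if i == 0 then if j == 0 then a else b else (j == 0)%:R.

(** With M the companion matrix, 1 - a t - b t^2 is the determinant of 1 - t M,
    so the product is the determinant of \prod (1 - w^m M) = 1 - M^p, and
    det (1 - B) = 1 - tr B + det B for 2 x 2 matrices.  The traces of the powers
    of M are the Lucas polynomials in a and b; writing them in this way shows at
    once that their coefficients are nonnegative.  Only the polynomial identity
    satisfied by w is assumed, so that it can be a constant of a polynomial
    ring. *)
Lemma prod_companion2 (A : comNzRingType) (p : nat) (w a b : A) :
  \prod_(m < p) (1 - (w ^+ m)%:P * 'X) = 1 - 'X^p ->
  \prod_(m < p) (1 - (w ^+ m * a + (w ^+ 2) ^+ m * b)) =
    1 - (\tr (companion2 a b ^+ p) - (- b) ^+ p).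
Proof.
move=> pw; set M := companion2 a b.
have detM : \det M = - b by rewrite det_mx2 !mxE /=; ring.
have det1B (B : 'M[A]_2) : \det (1 - B) = 1 - (\tr B - \det B).
  by rewrite !det_mx2 trace_mx2 !mxE /=; ring.
have detX k : \det (M ^+ k) = (- b) ^+ k.
  elim: k => [|k IHk]; first by rewrite !expr0 det1.
  by rewrite exprS det_mulmx IHk detM -exprS.
rewrite -detX -det1B.
have <- : \prod_(m < p) (1 - w ^+ m *: M) = 1 - M ^+ p.
  have := congr1 (horner_mx M) pw.
  rewrite rmorph_prod /= raddfB /= rmorph1 rmorphXn /= horner_mx_X => <-.
  apply: eq_bigr => m _; rewrite raddfB /= rmorph1 rmorphM /= horner_mx_X.
  by rewrite horner_mx_C -[_ * M]/(_ *m _) mul_scalar_mx.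
rewrite (big_morph (fun B : 'M[A]_2 => \det B) (id1 := 1) (op1 := *%R));
  [|exact: det_mulmx|exact: det1].
apply: eq_bigr => m _; rewrite det_mx2 !mxE /= exprAC.
ring.
Qed.

(** Only the monomials a^i b^j c^k with i + 2 j + 4 k divisible by 7 survive; the
    cyclic symmetry a -> b -> c -> a of the right-hand side comes from the
    automorphism w -> w^2. *)
Lemma prod_seventh_roots (A : comNzRingType) (w a b c : A) :
  1 + w + w ^+ 2 + w ^+ 3 + w ^+ 4 + w ^+ 5 + w ^+ 6 = 0 ->
  \prod_(m < 7) (1 - (w ^+ m * a + (w ^+ 2) ^+ m * b + (w ^+ 4) ^+ m * c)) =
  1 - (a ^+ 7 + b ^+ 7 + c ^+ 7
       + (a ^+ 5 * b + b ^+ 5 * c + c ^+ 5 * a) *+ 7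
       + (a * b ^+ 3 + b * c ^+ 3 + c * a ^+ 3) *+ 7
       + (a ^+ 3 * b ^+ 2 + b ^+ 3 * c ^+ 2 + c ^+ 3 * a ^+ 2) *+ 14
       + (a * b * c) *+ 14
       + (a * b ^+ 2 * c ^+ 4 + b * c ^+ 2 * a ^+ 4 + c * a ^+ 2 * b ^+ 4) *+ 7
       + (a ^+ 2 * b ^+ 2 * c ^+ 2) *+ 7).
Proof.
move=> w7.
have {w7} w6 : w ^+ 6 = - (1 + w + w ^+ 2 + w ^+ 3 + w ^+ 4 + w ^+ 5).
  by apply/eqP; rewrite -subr_eq0 opprK addrC w7.
rewrite !big_ord_recl big_ord0 /= /bump /=.
ring: w6.
Qed.

(** * Sums of Hermitian squares *)

(** A polynomial g in the z_j, seen among the polynomials in z and conj z;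
    [wpart g] is the conjugate of g, a polynomial in the conjugates of the
    z_j. *)
Definition zpart (C : numClosedFieldType) (n : nat) : mpoly n C -> mpoly (n + n) C :=
  mmap (@mpolyC (n + n) C) (fun j => mpolyX C (mnm1 (lshift n j))).

Definition wpart (C : numClosedFieldType) (n : nat) : mpoly n C -> mpoly (n + n) C :=
  mmap (@mpolyC (n + n) C \o Num.conj) (fun j => mpolyX C (mnm1 (rshift n j))).

(** Evaluation at this point polarizes: it gives w, not z, to the variables that
    stand for the conjugates. *)
Definition zwpoint (C : numClosedFieldType) (n : nat) (z w : 'I_n -> C) :
    'I_(n + n) -> C :=
  fun i => match fintype.split i with inl j => z j | inr j => Num.conj (w j) end.

Definition herm_sos (C : numClosedFieldType) (n : nat) (K : mpoly (n + n) C) : Prop :=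
  exists s : seq (mpoly n C), K = \sum_(g <- s) zpart g * wpart g.

HB.instance Definition _ (C : numClosedFieldType) (n : nat) :=
  GRing.RMorphism.copy (@zpart C n)
   (mmap (@mpolyC (n + n) C) (fun j => mpolyX C (mnm1 (lshift n j)))).
HB.instance Definition _ (C : numClosedFieldType) (n : nat) :=
  GRing.RMorphism.copy (@wpart C n)
   (mmap (@mpolyC (n + n) C \o Num.conj) (fun j => mpolyX C (mnm1 (rshift n j)))).

Section HermitianSquares.
Variables (C : numClosedFieldType) (n : nat).
Implicit Types (K L : mpoly (n + n) C) (g h : mpoly n C).

Lemma zpartZ c g : zpart (c *: g) = c *: zpart g.
Proof. by rewrite /zpart mmapZ mul_mpolyC. Qed.

Lemma wpartZ c g : wpart (c *: g) = Num.conj c *: wpart g.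
Proof. by rewrite /wpart mmapZ /= mul_mpolyC. Qed.

Lemma zpartX (i : 'I_n) : zpart (mpolyX C (mnm1 i)) = mpolyX C (mnm1 (lshift n i)).
Proof. by rewrite /zpart mmapX mmap1U. Qed.

Lemma wpartX (i : 'I_n) : wpart (mpolyX C (mnm1 i)) = mpolyX C (mnm1 (rshift n i)).
Proof. by rewrite /wpart mmapX mmap1U. Qed.

Lemma herm_sos1 : herm_sos (1 : mpoly (n + n) C).
Proof. by exists [:: 1]; rewrite big_seq1 !rmorph1 mulr1. Qed.

Lemma herm_sos0 : herm_sos (0 : mpoly (n + n) C).
Proof. by exists [::]; rewrite big_nil. Qed.

Lemma herm_sosD K L : herm_sos K -> herm_sos L -> herm_sos (K + L).
Proof. by move=> [s ->] [t ->]; exists (s ++ t); rewrite big_cat. Qed.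

(** This is the Schur product theorem in the form needed here: the product of
    the squares of g and h is the square of g h. *)
Lemma herm_sosM K L : herm_sos K -> herm_sos L -> herm_sos (K * L).
Proof.
move=> [s ->] [t ->]; exists [seq g * h | g <- s, h <- t].
rewrite big_distrl big_allpairs_dep; apply: eq_bigr => g _ /=.
by rewrite big_distrr; apply: eq_bigr => h _ /=; rewrite !rmorphM mulrACA.
Qed.

Lemma herm_sosX K k : herm_sos K -> herm_sos (K ^+ k).
Proof.
move=> sK; elim: k => [|k IHk]; first exact: herm_sos1.
by rewrite exprS; apply: herm_sosM.
Qed.

Lemma herm_sosMn K k : herm_sos K -> herm_sos (K *+ k).
Proof.
move=> sK; elim: k => [|k IHk]; first exact: herm_sos0.
by rewrite mulrS; apply: herm_sosD.
Qed.

Lemma herm_sos_sum (I : Type) (r : seq I) (P : pred I) (F : I -> mpoly (n + n) C) :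
  (forall i, P i -> herm_sos (F i)) -> herm_sos (\sum_(i <- r | P i) F i).
Proof. by move=> sF; apply: big_ind => //; [exact: herm_sos0|exact: herm_sosD]. Qed.

Lemma meval_zpart z w g : meval (zwpoint z w) (zpart g) = meval z g.
Proof.
rewrite /zpart /mmap [RHS]mevalE raddf_sum /=; apply: eq_bigr => m _.
rewrite mevalM mevalC rmorph_prod /=; congr (_ * _); apply: eq_bigr => i _.
by rewrite rmorphXn /= mevalXU /zwpoint -[lshift n i]/(unsplit (inl i)) unsplitK.
Qed.

Lemma meval_wpart z w g : meval (zwpoint z w) (wpart g) = Num.conj (meval w g).
Proof.
rewrite /wpart /mmap [in RHS]mevalE raddf_sum rmorph_sum /=; apply: eq_bigr => m _.
rewrite mevalM mevalC rmorphM !rmorph_prod /=; congr (_ * _); apply: eq_bigr => i _.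
by rewrite !rmorphXn /= mevalXU /zwpoint -[rshift n i]/(unsplit (inr i)) unsplitK.
Qed.

Lemma eq_mnm_pair (a b a' b' : multinom n) :
  (mnm_pair a b == mnm_pair a' b') = (a == a') && (b == b').
Proof.
have pl (c d : multinom n) i : mnm_pair c d (lshift n i) = c i.
  by rewrite mnmE -[lshift n i]/(unsplit (inl i)) unsplitK.
have pr (c d : multinom n) i : mnm_pair c d (rshift n i) = d i.
  by rewrite mnmE -[rshift n i]/(unsplit (inr i)) unsplitK.
apply/eqP/andP => [e|[/eqP-> /eqP->] //].
by split; apply/eqP/mnmP => i;
  [rewrite -(pl a b) e pl | rewrite -(pr a b) e pr].
Qed.

Lemma mpolyX_mnm_pair (a b : multinom n) :
  mpolyX C (mnm_pair a b) =
  (\prod_(i < n) mpolyX C (mnm1 (lshift n i)) ^+ a i) *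
  (\prod_(i < n) mpolyX C (mnm1 (rshift n i)) ^+ b i).
Proof.
rewrite mpolyXE_id big_split_ord /=; congr (_ * _); apply: eq_bigr => i _.
  by rewrite mnmE -[lshift n i]/(unsplit (inl i)) unsplitK.
by rewrite mnmE -[rshift n i]/(unsplit (inr i)) unsplitK.
Qed.

(** Hence the coefficient matrix of a sum of Hermitian squares is a sum of
    matrices u u^*, with u the coefficient vectors. *)
Lemma mcoeff_mnm_pair (a b : multinom n) g h :
  mcoeff (mnm_pair a b) (zpart g * wpart h) = mcoeff a g * Num.conj (mcoeff b h).
Proof.
rewrite /zpart /wpart /mmap big_distrl /= raddf_sum /=.
rewrite [g in RHS]mpolyE raddf_sum /= big_distrl /=; apply: eq_bigr => m _.
rewrite [h in RHS]mpolyE !raddf_sum /= !big_distrr raddf_sum; apply: eq_bigr => m' _ /=.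
rewrite !mul_mpolyC -scalerAl -scalerAr -mpolyX_mnm_pair !mcoeffZ !mcoeffX.
by rewrite eq_mnm_pair rmorphM rmorph_nat -mulnb natrM; ring.
Qed.
End HermitianSquares.

#[global] Opaque zpart wpart.

Section HermitianSquaresOfProducts.
Variables (C : numClosedFieldType) (n : nat).
Implicit Types (a b c : mpoly (n + n) C).

Lemma prod_one_sub_prim_root_mpoly (p : nat) (w : C) :
  p.-primitive_root w ->
  \prod_(m < p) (1 - (mpolyC (n + n) w ^+ m)%:P * 'X) = 1 - 'X^p.
Proof.
move=> pw; have := congr1 (map_poly (@mpolyC (n + n) C)) (prod_one_sub_prim_root pw).
rewrite rmorph_prod rmorphB rmorph1 /= map_polyXn => <-.
apply: eq_bigr => m _.
by rewrite rmorphB rmorph1 rmorphM /= map_polyC /= map_polyX !rmorphXn.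
Qed.

Lemma herm_sos_prod_one (p : nat) (w : C) a :
  p.-primitive_root w -> herm_sos a ->
  herm_sos (1 - \prod_(m < p) (1 - w ^+ m *: a)).
Proof.
move=> pw sa.
have := congr1 (horner^~ a) (prod_one_sub_prim_root_mpoly pw).
rewrite /= horner_prod !(hornerD, hornerN, hornerC, hornerXn) => prodE.
have -> : \prod_(m < p) (1 - w ^+ m *: a) = 1 - a ^+ p.
  rewrite -prodE; apply: eq_bigr => m _.
  rewrite !(hornerD, hornerN, hornerM, hornerC, hornerX).
  by rewrite -mul_mpolyC rmorphXn.
by rewrite opprB addrC subrK; apply: herm_sosX.
Qed.

(** The entries of the powers of the companion matrix are sums of products of
    a, b and 1. *)
Lemma herm_sos_prod_two (p : nat) (w : C) a b :
  odd p -> p.-primitive_root w -> herm_sos a -> herm_sos b ->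
  herm_sos (1 - \prod_(m < p) (1 - (w ^+ m *: a + (w ^+ 2) ^+ m *: b))).
Proof.
move=> p_odd pw sa sb.
have -> : \prod_(m < p) (1 - (w ^+ m *: a + (w ^+ 2) ^+ m *: b)) =
    \prod_(m < p) (1 - ((mpolyC (n + n) w) ^+ m * a + (mpolyC (n + n) w ^+ 2) ^+ m * b)).
  by apply: eq_bigr => m _; rewrite -!mul_mpolyC !rmorphXn.
rewrite (prod_companion2 _ _ (prod_one_sub_prim_root_mpoly pw)).
have sM k i j : herm_sos ((companion2 a b ^+ k) i j).
  elim: k i j => [|k IHk] i j.
    by rewrite expr0 mxE; apply: herm_sosMn; exact: herm_sos1.
  rewrite exprS mxE; apply: herm_sos_sum => l _; apply: herm_sosM => //.
  rewrite mxE; case: eqP => _; first by case: eqP.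
  by apply: herm_sosMn; exact: herm_sos1.
rewrite opprB addrC subrK exprNn -signr_odd p_odd expr1 mulN1r opprK.
apply: herm_sosD; last exact: herm_sosX.
by apply: herm_sos_sum.
Qed.

Lemma herm_sos_prod_three (w : C) a b c :
  7.-primitive_root w -> herm_sos a -> herm_sos b -> herm_sos c ->
  herm_sos (1 - \prod_(m < 7)
     (1 - (w ^+ m *: a + (w ^+ 2) ^+ m *: b + (w ^+ 4) ^+ m *: c))).
Proof.
move=> pw sa sb sc; pose v := mpolyC (n + n) w.
have v7 : 1 + v + v ^+ 2 + v ^+ 3 + v ^+ 4 + v ^+ 5 + v ^+ 6 = 0.
  have w_neq1 : w - 1 != 0.
    rewrite subr_eq0 -(expr1 w) -[X in _ == X](expr0 w).
    by rewrite (eq_prim_root_expr pw).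
  have w7 : 1 + w + w ^+ 2 + w ^+ 3 + w ^+ 4 + w ^+ 5 + w ^+ 6 = 0.
    apply: (mulfI w_neq1); rewrite mulr0 -(subrr (w ^+ 7)).
    by rewrite [X in _ = _ - X](prim_expr_order pw); ring.
  by rewrite -[RHS](mpolyC0 (n + n) C) -w7 !rmorphD !rmorphXn rmorph1.
have -> : \prod_(m < 7) (1 - (w ^+ m *: a + (w ^+ 2) ^+ m *: b + (w ^+ 4) ^+ m *: c)) =
    \prod_(m < 7) (1 - (v ^+ m * a + (v ^+ 2) ^+ m * b + (v ^+ 4) ^+ m * c)).
  by apply: eq_bigr => m _; rewrite -!mul_mpolyC !rmorphXn.
rewrite (prod_seventh_roots _ _ _ v7) opprB addrC subrK.
by repeat first [assumption | apply: herm_sosD | apply: herm_sosMn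
                | apply: herm_sosM | apply: herm_sosX].
Qed.
End HermitianSquaresOfProducts.

(** * The polynomial of an admissible group is a sum of Hermitian squares *)

Lemma diag_mxX (A : comPzRingType) (n m : nat) (d : 'rV[A]_n) :
  diag_mx d ^+ m = diag_mx (\row_l (d 0 l) ^+ m).
Proof.
elim: m => [|m IHm].
  by rewrite expr0 -[LHS]/(1%:M) -diag_const_mx; congr diag_mx; apply/rowP => l;
     rewrite !mxE expr0.
rewrite exprS IHm -[_ * _]/(_ *m _) mulmx_diag; congr diag_mx; apply/rowP => l.
by rewrite !mxE exprS.
Qed.

Section AdmissibleGroups.
Variables (R : realType) (n : nat).
Local Notation C := R[i].
Implicit Types (Gamma : {fset 'M[C]_n}) (U D : 'M[C]_n) (d : 'rV[C]_n).

(** The l-th coordinate of U^* z, as a polynomial in z. *)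
Definition rotated_coord U (l : 'I_n) : mpoly n C :=
  \sum_(j < n) Num.conj (U j l) *: mpolyX C (mnm1 j).

Definition rotated_square U (l : 'I_n) : mpoly (n + n) C :=
  zpart (rotated_coord U l) * wpart (rotated_coord U l).

Lemma herm_sos_rotated_square U (P : pred 'I_n) :
  herm_sos (\sum_(l < n | P l) rotated_square U l).
Proof.
by apply: herm_sos_sum => l _; exists [:: rotated_coord U l]; rewrite big_seq1.
Qed.

Lemma herm_poly_diag U d :
  herm_poly (U *m diag_mx d *m U^t*) = \sum_(l < n) d 0 l *: rotated_square U l.
Proof.
rewrite /herm_poly.
have sqE l : rotated_square U l = \sum_(i < n) \sum_(j < n) (U i l * Num.conj (U j l)) *:
    (mpolyX C (mnm1 (lshift n j)) * mpolyX C (mnm1 (rshift n i))).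
  rewrite /rotated_square /rotated_coord !raddf_sum /= mulr_sumr; apply: eq_bigr => i _.
  rewrite mulr_suml; apply: eq_bigr => j _.
  rewrite zpartZ wpartZ conjCK zpartX wpartX.
  by rewrite -scalerAl -scalerAr scalerA mulrC.
under [RHS]eq_bigr do rewrite sqE scaler_sumr.
rewrite [RHS]exchange_big; apply: eq_bigr => i _ /=.
under [RHS]eq_bigr do rewrite scaler_sumr.
rewrite [RHS]exchange_big; apply: eq_bigr => j _ /=.
rewrite mxE scaler_suml; apply: eq_bigr => l _.
by rewrite mul_mx_diag !mxE scalerA; congr (_ *: _); ring.
Qed.

(** The index l0 provides an eigenvalue of order exactly p, which makes the
    powers of exponent less than p distinct; they are then all the elements of
    Gamma. *)
Lemma prod_cyclic Gamma U d (p : nat) (w : C) (l0 : 'I_n) :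
  U \is unitarymx -> p.-primitive_root w -> d 0 l0 = w ->
  (forall l, d 0 l ^+ p = 1) ->
  (forall g, g \in Gamma <-> exists m : nat, g = U *m (diag_mx d ^+ m) *m U^t*) ->
  1 - \prod_(m < p) (1 - \sum_(l < n) (d 0 l) ^+ m *: rotated_square U l) = Phi Gamma.
Proof.
move=> unitU pw dl0 dp GammaE; congr (1 - _).
pose g m := U *m (diag_mx d ^+ m) *m U^t*.
have g_mod m : g m = g (m %% p)%N.
  rewrite /g !diag_mxX; congr (_ *m diag_mx _ *m _); apply/rowP => l; rewrite !mxE.
  by rewrite {1}(divn_eq m p) exprD mulnC exprM dp expr1n mul1r.
have perm_g : perm_eq (enum_fset Gamma) [seq g m | m <- iota 0 p].
  apply: uniq_perm; first exact: fset_uniq.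
    rewrite map_inj_in_uniq ?iota_uniq // => i j.
    rewrite !mem_iota /= add0n => lt_i lt_j /(congr1 (fun M => U^t* *m M *m U)).
    rewrite /g !mulmxA -(invmx_unitary unitU) !mulVmx ?unitarymx_unit // !mul1mx.
    rewrite !mulmxKV ?unitarymx_unit // !diag_mxX => /matrixP/(_ l0 l0).
    rewrite !mxE eqxx !mulr1n dl0 => /eqP; rewrite (eq_prim_root_expr pw) !modn_small //.
    by move/eqP.
  move=> h; apply/idP/mapP => [/GammaE[m ->]|[m _ ->]]; last by apply/GammaE; exists m.
  exists (m %% p)%N; last exact: g_mod.
  by rewrite mem_iota /= ltn_mod (prim_order_gt0 pw).
rewrite (perm_big _ perm_g) big_map -[X in iota 0 X]subn0 -/(index_iota 0 p) big_mkord.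
by apply: eq_bigr => m _; rewrite /g diag_mxX herm_poly_diag;
   congr (1 - _); apply: eq_bigr => l _; rewrite mxE.
Qed.

(** In each case the sum over l is split along the blocks of the generator. *)
Lemma Phi_herm_sos Gamma : (0 < n)%N -> admissible Gamma -> herm_sos (Phi Gamma).
Proof.
move=> n_gt0 [_ [D [caseD [U unitU GammaE]]]].
case: caseD => [[p [w [pw DE]]]|[p [k [w [p_odd pw /andP[k_gt0 lt_kn] DE]]]]|].
- pose l0 := Ordinal n_gt0; rewrite -diag_const_mx in DE; subst D.
  rewrite -(prod_cyclic (l0 := l0) (p := p) (w := w) unitU _ _ _ GammaE) ?mxE //; last first.
    by move=> l; rewrite mxE (prim_expr_order pw).
  under eq_bigr => m _ do under eq_bigr => l _ do rewrite mxE.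
  under eq_bigr => m _ do rewrite -scaler_sumr.
  by apply: herm_sos_prod_one => //; apply: herm_sos_rotated_square.
- pose l0 := Ordinal n_gt0; subst D.
  rewrite -(prod_cyclic (l0 := l0) (p := p) (w := w) unitU _ _ _ GammaE) ?mxE ?k_gt0 //;
    last first.
    move=> l; rewrite mxE; case: ifP => _; first exact: (prim_expr_order pw).
    by rewrite exprAC (prim_expr_order pw) expr1n.
  have dE m :
      \sum_(l < n) ((\row_(i < n) if (i < k)%N then w else w ^+ 2) 0 l) ^+ m *:
        rotated_square U l =
      w ^+ m *: (\sum_(l < n | (l < k)%N) rotated_square U l)
      + (w ^+ 2) ^+ m *: (\sum_(l < n | ~~ (l < k)%N) rotated_square U l).
    rewrite (bigID (fun l : 'I_n => (l < k)%N)) /= !scaler_sumr.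
    by congr (_ + _); apply: eq_bigr => l; rewrite mxE; [move=> ->|move/negbTE->].
  under eq_bigr => m _ do rewrite dE.
  by apply: herm_sos_prod_two => //; apply: herm_sos_rotated_square.
- move=> [j [k [w [pw j_gt0 k_gt0 lt_jkn DE]]]].
  pose l0 := Ordinal n_gt0; subst D.
  rewrite -(prod_cyclic (l0 := l0) (p := 7) (w := w) unitU _ _ _ GammaE) ?mxE ?j_gt0 //;
    last first.
    by move=> l; rewrite mxE; do ?[case: ifP => _];
       rewrite ?[(w ^+ _) ^+ 7]exprAC (prim_expr_order pw) ?expr1n.
  have dE m : \sum_(l < n) ((\row_(i < n) if (i < j)%N then w
                                  else if (i < j + k)%N then w ^+ 2
                                  else w ^+ 4) 0 l) ^+ m *: rotated_square U l
     = w ^+ m *: (\sum_(l < n | (l < j)%N) rotated_square U l)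
      + (w ^+ 2) ^+ m *: (\sum_(l < n | ~~ (l < j)%N && (l < j + k)%N) rotated_square U l)
      + (w ^+ 4) ^+ m *: (\sum_(l < n | ~~ (l < j)%N && ~~ (l < j + k)%N) rotated_square U l).
    rewrite (bigID (fun l : 'I_n => (l < j)%N)) /= -addrA; congr (_ + _).
      by rewrite scaler_sumr; apply: eq_bigr => l; rewrite mxE => ->.
    rewrite (bigID (fun l : 'I_n => (l < j + k)%N)) /= !scaler_sumr.
    by congr (_ + _); apply: eq_bigr => l; rewrite mxE => /andP[/negbTE->];
       [move=> ->|move/negbTE->].
  under eq_bigr => m _ do rewrite dE.
  by apply: herm_sos_prod_three => //; apply: herm_sos_rotated_square.
Qed.
End AdmissibleGroups.

(** * A linearly independent system of squares *)

Lemma perm_eq_prod_XsubC (F : fieldType) (s t : seq F) :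
  \prod_(x <- s) ('X - x%:P) = \prod_(x <- t) ('X - x%:P) -> perm_eq s t.
Proof.
elim: s t => [|x s IHs] t eq_st.
  have := congr1 (fun q : {poly F} => size q) eq_st.
  by rewrite !size_prod_XsubC => -[/esym/size0nil->].
have t_x : x \in t by rewrite -root_prod_XsubC -eq_st root_prod_XsubC mem_head.
have perm_t := perm_to_rem t_x; rewrite perm_sym (permPl perm_t) perm_cons perm_sym.
apply: IHs; apply: (@mulfI _ ('X - x%:P)); first by rewrite polyXsubC_eq0.
by rewrite -[RHS](big_cons _ _ _ _ predT) -(perm_big _ perm_t) -eq_st big_cons.
Qed.

Lemma char_poly_conj (F : fieldType) (n : nat) (P A : 'M[F]_n) :
  P \in unitmx -> char_poly (invmx P *m A *m P) = char_poly A.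
Proof.
move=> unitP; rewrite /char_poly /char_poly_mx.
have PK : map_mx polyC (invmx P) *m map_mx polyC P = 1%:M.
  by rewrite -map_mxM mulVmx // map_mx1.
have -> : 'X%:M - map_mx polyC (invmx P *m A *m P) =
    map_mx polyC (invmx P) *m ('X%:M - map_mx polyC A) *m map_mx polyC P.
  rewrite mulmxBr mulmxBl !map_mxM; congr (_ - _).
  by rewrite mul_mx_scalar -scalemxAl PK scalemx1.
by rewrite !det_mulmx mulrAC -det_mulmx PK det1 mul1r.
Qed.

Lemma eigenvalues_conj_diag (R : realType) (m : nat) (P : 'M[R[i]]_m) (d : 'rV[R[i]]_m) :
  P \in unitmx ->
  perm_eq (eigenvalues (invmx P *m diag_mx d *m P)) [seq d 0 k | k <- enum 'I_m].
Proof.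
move=> unitP; apply: perm_eq_prod_XsubC; rewrite /eigenvalues.
case: closed_field_poly_normal => r /=.
rewrite (monicP (char_poly_monic _)) scale1r => <-.
rewrite char_poly_conj // char_poly_trig ?diag_mx_is_trig // big_map big_enum /=.
by apply: eq_bigr => k _; rewrite mxE eqxx mulr1n.
Qed.

Lemma big_sig (V : nmodType) (I : finType) (P : pred I) (F : I -> V) :
  \sum_(k | P k) F k = \sum_(x : {k | P k}) F (val x).
Proof.
rewrite (reindex_omap (val : {k | P k} -> I) insub) => [|k Pk]; last by rewrite insubT.
by apply: eq_bigl => x; rewrite valP valK eqxx.
Qed.

Definition lin_indep (C : numClosedFieldType) (n : nat) (I : finType) (f : I -> mpoly n C) :=
  forall a : I -> C, \sum_k a k *: f k = 0 -> forall k, a k = 0.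

Lemma lin_indep_reindex (C : numClosedFieldType) (n : nat) (I J : finType)
    (f : I -> mpoly n C) (s : J -> I) :
  bijective s -> lin_indep f -> lin_indep (f \o s).
Proof.
move=> [s' sK s'K] free_f a sum0 k; rewrite -[k]sK; apply: (free_f (a \o s')).
rewrite (reindex s) /=; last by exists s' => ? _; rewrite ?sK ?s'K.
by rewrite -[RHS]sum0; apply: eq_bigr => j _ /=; rewrite sK.
Qed.

Section SpectralDecomposition.
Variables (R : realType) (n : nat).
Local Notation C := R[i].
Implicit Types (Gamma : {fset 'M[C]_n}).

Lemma msize_herm_poly (g : 'M[C]_n) : (mmeasure mdeg (1 - herm_poly g) <= 3)%N.
Proof.
rewrite (leq_trans (msizeD_le _ _)) // msizeN geq_max msize1 /=.
apply: leq_trans (msize_sum _ _ _) _; apply/bigmax_leqP => i _.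
apply: leq_trans (msize_sum _ _ _) _; apply/bigmax_leqP => j _.
apply: leq_trans (msizeZ_le _ _) _.
by rewrite -mpolyXD msizeX mdegD !mdeg1.
Qed.

Lemma msize_Phi Gamma : (mmeasure mdeg (Phi Gamma) <= (2 * #|` Gamma|).+1)%N.
Proof.
rewrite /Phi (leq_trans (msizeD_le _ _)) // msizeN geq_max msize1 /=.
elim: (enum_fset Gamma) => [|g s IHs].
  by rewrite big_nil msize1.
rewrite big_cons; set p := \prod_(_ <- s) _ in IHs *.
have [->|p_neq0] := eqVneq p 0; first by rewrite mulr0 mmeasure0.
have [->|h_neq0] := eqVneq (1 - herm_poly g) 0; first by rewrite mul0r mmeasure0.
rewrite msizeM //=; have := msize_herm_poly g; move: IHs.
by set u := mmeasure _ _; set v := mmeasure _ _; lia.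
Qed.

(** The polynomial of degree less than k with a given coefficient vector, indexed
    like the rows of [coef_mx]. *)
Definition trunc_poly (k : nat) (v : 'I_#|{: bmultinom n k}| -> C) : mpoly n C :=
  \sum_i v i *: mpolyX C (bmnm (enum_val i)).

Lemma mcoeff_trunc_poly k (v : 'I_#|{: bmultinom n k}| -> C) i :
  mcoeff (bmnm (enum_val i)) (trunc_poly v) = v i.
Proof.
rewrite /trunc_poly raddf_sum (bigD1 i) //= big1 => [|j ne_ji].
  by rewrite addr0 mcoeffZ mcoeffX eqxx mulr1.
rewrite mcoeffZ mcoeffX -[_ == _]/(enum_val j == enum_val i).
by rewrite (inj_eq enum_val_inj) (negbTE ne_ji) mulr0.
Qed.

Lemma trunc_polyE k (g : mpoly n C) : (mmeasure mdeg g <= k)%N ->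
  trunc_poly (fun i : 'I_#|{: bmultinom n k}| => mcoeff (bmnm (enum_val i)) g) = g.
Proof. by move=> le_g; rewrite [RHS](mpolywE le_g) [RHS]big_enum_val. Qed.

Lemma trunc_poly_square k (u : 'I_#|{: bmultinom n k}| -> C) :
  zpart (trunc_poly u) * wpart (trunc_poly u) =
  \sum_i \sum_j (u i * Num.conj (u j)) *:
     (zpart (mpolyX C (bmnm (enum_val i))) * wpart (mpolyX C (bmnm (enum_val j)))).
Proof.
rewrite /trunc_poly !raddf_sum big_distrl /=; apply: eq_bigr => i _.
rewrite [LHS]mulr_sumr; apply: eq_bigr => j _.
by rewrite zpartZ wpartZ -scalerAl -scalerAr scalerA.
Qed.

(** If the coefficient of z^m in g is not zero, then the diagonal coefficient of
    Phi at z^m conj z^m, a sum of squared moduli, is not zero either; but Phi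
    has degree at most 2 #|Gamma|.  So the finite matrix [coef_mx] sees all
    coefficients of g. *)
Lemma msize_sos_term Gamma (s : seq (mpoly n C)) (g : mpoly n C) :
  Phi Gamma = \sum_(g <- s) zpart g * wpart g -> g \in s ->
  (mmeasure mdeg g <= #|` Gamma|.+1)%N.
Proof.
move=> PhiE s_g; rewrite msizeE; apply/bigmax_leqP_seq => m supp_m _.
rewrite ltnNge; apply/negP => lt_m.
have : mcoeff (mnm_pair m m) (Phi Gamma) = 0.
  apply: memN_msupp_eq0; apply: msize_mdeg_ge; apply: leq_trans (msize_Phi _) _.
  rewrite mdegE big_split_ord /=.
  under eq_bigr do rewrite mnmE -[lshift n _]/(unsplit (inl _)) unsplitK.
  under [X in (_ + X)%N]eq_bigr do rewrite mnmE -[rshift n _]/(unsplit (inr _)) unsplitK.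
  by rewrite -!mdegE mul2n -addnn; exact: (leq_add lt_m (ltnW lt_m)).
rewrite PhiE raddf_sum /=.
under eq_bigr do rewrite mcoeff_mnm_pair.
move/eqP; rewrite psumr_eq0 => [/allP/(_ g s_g)|h _]; last exact: mul_conjC_ge0.
by rewrite implyTb mul_conjC_eq0 mcoeff_eq0 supp_m.
Qed.

(** By the spectral theorem the coefficient matrix is P^* diag(d) P; as it is
    positive semidefinite, no eigenvalue is negative, and the f_k are the rows
    of P with d_k != 0, conjugated and scaled by the square root of d_k. *)
Lemma Phi_lin_indep_sos Gamma : herm_sos (Phi Gamma) ->
  exists2 f : 'I_(NGamma Gamma) -> mpoly n C,
    Phi Gamma = \sum_k zpart (f k) * wpart (f k) & lin_indep f.
Proof.
move=> [s PhiE].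
pose M := coef_mx Gamma; pose P := spectralmx M; pose d := spectral_diag M.
have unitP : P \is unitarymx by exact: spectral_unitarymx.
have ME i j : M i j = \sum_(g <- s)
    mcoeff (bmnm (enum_val i)) g * Num.conj (mcoeff (bmnm (enum_val j)) g).
  by rewrite mxE PhiE raddf_sum; apply: eq_bigr => g _; rewrite /= mcoeff_mnm_pair.
have hermM : M \is hermsymmx.
  apply/is_hermitianmxP; rewrite expr0 scale1r; apply/matrixP => i j.
  rewrite [LHS]ME [RHS]mxE [X in Num.conj X]mxE ME rmorph_sum; apply: eq_bigr => g _ /=.
  by rewrite rmorphM /= conjCK mulrC.
have Mdiag : M = invmx P *m diag_mx d *m P.
  exact/orthomx_spectralP/hermitian_normalmx.
(* d_k is the value of the form M at the k-th row of P. *)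
have d_ge0 k : 0 <= d 0 k.
  have -> : d 0 k = (P *m M *m P^t*) k k.
    rewrite Mdiag -(invmx_unitary unitP) !mulmxA mulmxV ?unitarymx_unit //.
    by rewrite mul1mx mulmxK ?unitarymx_unit // mxE eqxx mulr1n.
  have -> : (P *m M *m P^t*) k k = \sum_(g <- s)
      (\sum_i P k i * mcoeff (bmnm (enum_val i)) g) *
      Num.conj (\sum_i P k i * mcoeff (bmnm (enum_val i)) g).
    rewrite mxE; under eq_bigr => j _ do rewrite mxE big_distrl /=.
    rewrite exchange_big /=.
    under eq_bigr => i _ do under eq_bigr => j _ do rewrite ME !big_distrr big_distrl /=.
    under eq_bigr => i _ do rewrite exchange_big /=.
    rewrite exchange_big /=; apply: eq_bigr => g _.
    rewrite big_distrl; apply: eq_bigr => i _ /=.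
    rewrite rmorph_sum big_distrr; apply: eq_bigr => j _ /=.
    by rewrite !mxE rmorphM /=; ring.
  by apply: sumr_ge0 => g _; exact: mul_conjC_ge0.
have permM := eigenvalues_conj_diag d (unitarymx_unit unitP).
rewrite -Mdiag in permM.
pose K := {k | d 0 k != 0}.
have cardK : NGamma Gamma = #|{: K}|.
  rewrite /NGamma /Npos /Nneg !(permP permM) !(count_map (fun k => d 0 k)) -count_predUI.
  have /eq_count-> : predI (preim (d 0) [pred x | 0 < x]) (preim (d 0) [pred x | x < 0])
      =1 pred0.
    by move=> k /=; apply/negP => /andP[_ /lt_geF]; rewrite d_ge0.
  rewrite count_pred0 addn0.
  rewrite enumT card_sig [RHS]cardE size_filter; apply: eq_count => k /=.
  by rewrite inE lt_neqAle d_ge0 andbT eq_sym; case: eqP => //= ->; rewrite ltxx.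
pose F k i := sqrtC (d 0 k) * Num.conj (P k i).
have FE i j : \sum_k F k i * Num.conj (F k j) = M i j.
  rewrite Mdiag (invmx_unitary unitP) mxE; apply: eq_bigr => k _.
  rewrite mul_mx_diag !mxE rmorphM /= conjCK /F.
  rewrite (_ : Num.conj (sqrtC (d 0 k)) = sqrtC (d 0 k)); last first.
    by apply/CrealP/ger0_real; rewrite sqrtC_ge0.
  by rewrite -[in RHS](sqrtCK (d 0 k)); ring.
pose f (k : K) := trunc_poly (F (val k)).
have PhiF : Phi Gamma = \sum_k zpart (f k) * wpart (f k).
  transitivity (\sum_k zpart (trunc_poly (F k)) * wpart (trunc_poly (F k))).
    under [RHS]eq_bigr => k _ do rewrite trunc_poly_square.
    rewrite exchange_big /=.
    under [RHS]eq_bigr => i _ do (rewrite exchange_big /=;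
      under eq_bigr => j _ do rewrite -scaler_suml FE ME scaler_suml).
    under [RHS]eq_bigr => i _ do rewrite exchange_big /=.
    rewrite exchange_big /= PhiE [LHS]big_seq [RHS]big_seq; apply: eq_bigr => g s_g.
    have gE := trunc_polyE (msize_sos_term PhiE s_g).
    transitivity (zpart (trunc_poly (fun i : 'I_#|{: bmultinom n #|` Gamma|.+1}| =>
                           mcoeff (bmnm (enum_val i)) g)) *
                  wpart (trunc_poly (fun i : 'I_#|{: bmultinom n #|` Gamma|.+1}| =>
                           mcoeff (bmnm (enum_val i)) g))); first by rewrite gE.
    exact: trunc_poly_square.
  rewrite (bigID (fun k => d 0 k != 0)) /= [X in _ + X]big1 ?addr0 => [|k]; last first.
    rewrite negbK => /eqP dk0; rewrite [trunc_poly _](_ : _ = 0) ?raddf0 ?mul0r //.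
    by apply: big1 => i _; rewrite /F dk0 sqrtC0 mul0r scale0r.
  by rewrite big_sig.
have free_f : lin_indep f.
  move=> a sum0 k0.
  (* The a_k, scaled and extended by 0, form a row vector that the invertible
     matrix conj P annihilates. *)
  pose b k := oapp (fun k : K => a k * sqrtC (d 0 (val k))) 0 (insub k).
  have bP (k : K) : b (val k) = a k * sqrtC (d 0 (val k)) by rewrite /b valK.
  have b0 : (\row_k b k) *m (map_mx Num.conj P) = 0.
    apply/rowP => i; rewrite mxE [RHS]mxE.
    have := congr1 (mcoeff (bmnm (enum_val i))) sum0.
    rewrite mcoeff0 raddf_sum => sum0i; rewrite -[RHS]sum0i {sum0i} /=.
    rewrite (bigID (fun k => d 0 k != 0)) /= [X in _ + X]big1 ?addr0 => [|k dk0]; last first.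
      by rewrite !mxE /b insubF ?mul0r //; apply/negbTE.
    rewrite big_sig /=; apply: eq_bigr => k _.
    by rewrite mcoeffZ mcoeff_trunc_poly !mxE bP /F mulrA.
  have : (\row_k b k) 0 (val k0) = 0.
    suff -> : \row_k b k = 0 by rewrite mxE.
    have uP : map_mx Num.conj P \in unitmx by rewrite map_unitmx unitarymx_unit.
    by rewrite -[LHS](mulmxK uP) b0 mul0mx.
  rewrite mxE bP => /eqP; rewrite mulf_eq0 sqrtC_eq0 (negbTE (valP k0)) orbF.
  by move/eqP.
pose t (k : 'I_(NGamma Gamma)) : K := enum_val (cast_ord cardK k).
have bij_t : bijective t.
  exists (cast_ord (esym cardK) \o enum_rank) => k /=.
    by rewrite /t enum_valK cast_ordK.
  by rewrite /t cast_ordKV enum_rankK.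
exists (f \o t); last exact: lin_indep_reindex.
by rewrite PhiF (reindex t) //; exact: onW_bij.
Qed.
End SpectralDecomposition.

(** * Polynomials vanishing on the sphere *)

Lemma poly_eq0_inj (F : idomainType) (t : nat -> F) (q : {poly F}) :
  injective t -> (forall k, q.[t k] = 0) -> q = 0.
Proof.
move=> inj_t q0; apply/eqP; apply: contraT => q_neq0.
have := @max_poly_roots _ q [seq t k | k <- iota 0 (size q)] q_neq0.
rewrite size_map size_iota ltnn => -> //; last by rewrite map_inj_uniq ?iota_uniq.
by apply/allP => _ /mapP[k _ ->]; apply/rootP.
Qed.

(** Uniqueness of the expansion in base B. *)
Lemma digits_inj (n B : nat) (a b : 'I_n -> nat) :
  (forall i, a i < B)%N -> (forall i, b i < B)%N ->
  (\sum_(i < n) a i * B ^ i = \sum_(i < n) b i * B ^ i)%N -> a =1 b.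
Proof.
elim: n => [|n IHn] in a b * => aB bB; first by move=> _ [].
have E (c : 'I_n.+1 -> nat) :
    (\sum_(i < n.+1) c i * B ^ i = (\sum_(i < n) c (lift ord0 i) * B ^ i) * B + c ord0)%N.
  rewrite big_ord_recl expn0 muln1 addnC big_distrl; congr (_ + _)%N.
  by apply: eq_bigr => i _; rewrite /= expnS; lia.
rewrite !E => e.
have B_gt0 : (0 < B)%N := leq_ltn_trans (leq0n _) (aB ord0).
have e0 : a ord0 = b ord0.
  by have := congr1 (modn^~ B) e; rewrite /= !modnMDl !modn_small.
have eS := congr1 (divn^~ B) e; rewrite /= !divnMDl // !divn_small // !addn0 in eS.
have {}IHn := IHn (fun i => a (lift ord0 i)) (fun i => b (lift ord0 i))
  (fun i => aB _) (fun i => bB _) eS.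
by move=> i; case: (unliftP ord0 i) => [j|] -> //; apply: IHn.
Qed.

(** Kronecker substitution: at v_i = t^(B^i), with B larger than all exponents,
    distinct monomials become distinct powers of t. *)
Lemma meval_eq0 (C : numDomainType) (n : nat) (p : mpoly n C) :
  (forall v, meval v p = 0) -> p = 0.
Proof.
move=> p0; pose B := (mmeasure mdeg p).
pose e (m : multinom n) := (\sum_(i < n) m i * B ^ i)%N.
pose q : {poly C} := \sum_(m <- msupp p) mcoeff m p *: 'X^(e m).
have q0 : q = 0.
  apply: (@poly_eq0_inj _ (fun k => k%:R)) => [i j /eqP|k]; first by rewrite eqr_nat => /eqP.
  rewrite -[RHS](p0 (fun i => k%:R ^+ (B ^ i))) mevalE horner_sum.
  apply: eq_bigr => m _; rewrite hornerZ hornerXn -prodrXr; congr (_ * _).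
  by apply: eq_bigr => i _; rewrite mulnC exprM.
have mB m i : m \in msupp p -> (m i < B)%N.
  move=> /msize_mdeg_lt; apply: leq_ltn_trans.
  by rewrite mdegE (bigD1 i) //= leq_addr.
apply/mpolyP => m; rewrite mcoeff0.
have [supp_m|] := boolP (m \in msupp p); last exact: memN_msupp_eq0.
have := congr1 (fun r : {poly C} => r`_(e m)) q0.
rewrite coef0 coef_sum (bigD1_seq m) //= coefZ coefXn eqxx mulr1.
rewrite big_seq_cond big1 ?addr0 // => m' /andP[supp_m' ne_m'm].
rewrite coefZ coefXn; case: eqP => [em|_]; last by rewrite mulr0.
case/eqP: ne_m'm; apply/mnmP => i; apply/esym; move: i.
by apply: (@digits_inj _ B) => // i; exact: mB.
Qed.

Section VanishingOnSphere.
Variables (R : realType) (n : nat).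
Local Notation C := R[i].
Implicit Types (Gamma : {fset 'M[C]_n}) (z w : 'cV[C]_n) (p q : mpoly n C).

Definition peval p z : C := meval (fun j => z j 0) p.

(** Infinitely many points of the unit circle. *)
Definition unimodular (k : nat) : C := (1 + k%:R * 'i) / (1 - k%:R * 'i).

Lemma unimodular_conj k : unimodular k * Num.conj (unimodular k) = 1.
Proof.
have c1 : Num.conj (1 + k%:R * 'i) = 1 - k%:R * 'i :> C.
  by rewrite rmorphD rmorph1 rmorphM rmorph_nat /= conjCi mulrN.
have c2 : Num.conj (1 - k%:R * 'i) = 1 + k%:R * 'i :> C by rewrite -c1 conjCK.
have m_neq0 : (1 + k%:R * 'i) * (1 - k%:R * 'i) != 0 :> C.
  rewrite -[X in _ * X]c1 mul_conjC_eq0; apply/eqP => /(congr1 (fun x => 'Re x)).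
  rewrite raddfD /= ReMl ?realn // Re_i mulr0 addr0 raddf0.
  by move/Creal_ReP: (@real1 C) => -> /eqP; rewrite oner_eq0.
rewrite /unimodular rmorphM fmorphV /= c1 c2.
move: m_neq0; rewrite mulf_eq0 negb_or => /andP[h1 h2].
by field; rewrite h1 h2.
Qed.

Lemma unimodular_inj : injective unimodular.
Proof.
move=> k l; have m_neq0 j : (1 - j%:R * 'i) != 0 :> C.
  apply/eqP => /(congr1 (fun x => 'Re x)).
  rewrite raddfB /= ReMl ?realn // Re_i mulr0 subr0 raddf0.
  by move/Creal_ReP: (@real1 C) => -> /eqP; rewrite oner_eq0.
move/eqP; rewrite eqr_div ?m_neq0 // -subr_eq0.
rewrite (_ : _ - _ = (k%:R - l%:R) * (2%:R * 'i)); last by ring.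
rewrite !mulf_eq0 subr_eq0 eqr_nat pnatr_eq0 (negbTE (neq0Ci _)) /= orbF.
by move/eqP.
Qed.

Lemma sphere_scale (t : C) z : t * Num.conj t = 1 -> sphere z -> sphere (t *: z).
Proof.
rewrite /sphere /= /herm => t1 z1; rewrite -z1; apply: eq_bigr => j _.
by rewrite !mxE rmorphM mulrACA t1 mul1r.
Qed.

Lemma herm_ge0 z : 0 <= herm z z.
Proof. by apply: sumr_ge0 => j _; exact: mul_conjC_ge0. Qed.

Lemma herm_eq0 z : herm z z = 0 -> z = 0.
Proof.
move=> z0; apply/matrixP => j k; rewrite ord1 mxE {k}.
have {}z0 := psumr_eq0P (fun j _ => mul_conjC_ge0 (z j 0)) z0; have := z0 j isT.
by move/eqP; rewrite mul_conjC_eq0 => /eqP.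
Qed.

(** The polynomial t |-> p (t z). *)
Definition line_poly p z : {poly C} := mmap polyC (fun j => (z j 0)%:P * 'X) p.

Lemma horner_line_poly p z t : (line_poly p z).[t] = peval p (t *: z).
Proof.
rewrite /line_poly /peval mevalE /mmap horner_sum; apply: eq_bigr => m _.
rewrite hornerM hornerC horner_prod; congr (_ * _); apply: eq_bigr => j _.
by rewrite horner_exp hornerM hornerC hornerX mxE mulrC.
Qed.

Lemma delta_sphere (i : 'I_n) : sphere (delta_mx i 0 : 'cV[C]_n).
Proof.
rewrite /sphere /= /herm (bigD1 i) //= big1 => [|j ne_ji].
  by rewrite mxE !eqxx /= mulr1n rmorph1 mulr1 addr0.
by rewrite mxE (negbTE ne_ji) mul0r.
Qed.

(** For z on the sphere, the polynomial t |-> p (t z) vanishes on the unit circle,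
    an infinite set, hence everywhere. *)
Lemma eq0_on_sphere p : (0 < n)%N -> (forall z, sphere z -> peval p z = 0) -> p = 0.
Proof.
move=> n_gt0 p0.
have line0 z t : sphere z -> peval p (t *: z) = 0.
  move=> Sz; rewrite -horner_line_poly.
  rewrite (@poly_eq0_inj _ unimodular (line_poly p z)) ?horner0 // => [|k].
    exact: unimodular_inj.
  rewrite horner_line_poly p0 //.
  by apply: sphere_scale => //; exact: unimodular_conj.
suff pz z : peval p z = 0.
  apply: meval_eq0 => v; rewrite -[RHS](pz (\col_j v j)) /peval.
  by apply: meval_eq => j; rewrite mxE.
have [->|z_neq0] := eqVneq z 0.
  by rewrite -(scale0r (delta_mx (Ordinal n_gt0) 0)) line0 //; exact: delta_sphere.
pose r := sqrtC (herm z z).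
have hermE : herm z z = r * r by rewrite -expr2 sqrtCK.
have r_neq0 : r != 0.
  by rewrite sqrtC_eq0; apply: contra_neq z_neq0 => /herm_eq0.
have r_real : Num.conj r = r by apply/CrealP/ger0_real; rewrite sqrtC_ge0 herm_ge0.
rewrite -[z](scalerKV r_neq0) line0 // /sphere /= /herm.
under eq_bigr => j _ do rewrite !mxE rmorphM fmorphV /= r_real mulrACA.
rewrite -mulr_sumr -/(herm z z) hermE.
by rewrite mulrACA mulVf // mulr1.
Qed.

End VanishingOnSphere.

(** * The sphere map of an admissible group *)

Section KernelMap.
Variables (R : realType) (n : nat).
Local Notation C := R[i].
Implicit Types (Gamma : {fset 'M[C]_n}) (z w : 'cV[C]_n) (p q : mpoly n C).

Lemma meval_herm_poly (g : 'M[C]_n) z w :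
  meval (zwpoint (fun j => z j 0) (fun j => w j 0)) (herm_poly g) = herm (g *m z) w.
Proof.
rewrite /herm_poly /herm raddf_sum; apply: eq_bigr => i _ /=.
rewrite mxE mulr_suml raddf_sum; apply: eq_bigr => j _ /=.
rewrite mevalZ mevalM !mevalXU /zwpoint.
rewrite -[lshift n j]/(unsplit (inl j)) -[rshift n i]/(unsplit (inr i)) !unsplitK.
by rewrite mulrA.
Qed.

Definition Phi_kernel Gamma z w : C := 1 - \prod_(g <- Gamma) (1 - herm (g *m z) w).

Lemma meval_Phi Gamma z w :
  meval (zwpoint (fun j => z j 0) (fun j => w j 0)) (Phi Gamma) = Phi_kernel Gamma z w.
Proof.
rewrite /Phi /Phi_kernel mevalB meval1 rmorph_prod; congr (1 - _).
by apply: eq_bigr => g _; rewrite /= mevalB meval1 meval_herm_poly.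
Qed.

Lemma Phi_kernel_eq1 Gamma z w :
  finite_unitary_subgroup Gamma -> herm z w = 1 -> Phi_kernel Gamma z w = 1.
Proof.
case=> _ Gamma1 _ _ zw1; rewrite /Phi_kernel (big_rem _ Gamma1) /= mul1mx zw1.
by rewrite subrr mul0r subr0.
Qed.

Lemma Phi_kernel0 Gamma w : Phi_kernel Gamma 0 w = 0.
Proof.
rewrite /Phi_kernel big1 ?subrr // => g _; rewrite mulmx0 /herm big1 ?subr0 // => j _.
by rewrite mxE mul0r.
Qed.

Lemma Phi_kernel_inv Gamma g z w :
  finite_unitary_subgroup Gamma -> g \in Gamma ->
  Phi_kernel Gamma (g *m z) w = Phi_kernel Gamma z w.
Proof.
case=> unit_Gamma _ GammaM GammaV g_in; congr (1 - _).
have gU : g \in unitmx by apply/unitarymx_unit/unit_Gamma.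
have perm_g : perm_eq [seq h *m g | h <- enum_fset Gamma] (enum_fset Gamma).
  apply: uniq_perm; last 1 first.
  - move=> h; apply/mapP/idP => [[k k_in ->]|h_in]; first exact: GammaM.
    by exists (h *m invmx g); rewrite ?mulmxKV //; apply: GammaM => //; apply: GammaV.
  - by rewrite map_inj_uniq ?fset_uniq //; apply: can_inj (mulmxK gU).
  - exact: fset_uniq.
rewrite -[RHS](perm_big _ perm_g) big_map.
by apply: eq_bigr => h _; rewrite mulmxA.
Qed.

Definition kernel_map (I : finType) (f : I -> mpoly n C) z w : C :=
  \sum_k peval (f k) z * Num.conj (peval (f k) w).

Lemma kernel_mapE Gamma (I : finType) (f : I -> mpoly n C) z w :
  Phi Gamma = \sum_k zpart (f k) * wpart (f k) ->
  kernel_map f z w = Phi_kernel Gamma z w.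
Proof.
move=> PhiE; rewrite -meval_Phi PhiE raddf_sum; apply: eq_bigr => k _ /=.
by rewrite mevalM [X in _ = X * _]meval_zpart [X in _ = _ * X]meval_wpart.
Qed.

(** The conjugate of the hypothesis says that the combination of the f_k with
    coefficients conj u_k vanishes identically. *)
Lemma lin_indep_separates (I : finType) (f : I -> mpoly n C) (u : I -> C) :
  lin_indep f -> (forall w, \sum_k u k * Num.conj (peval (f k) w) = 0) ->
  forall k, u k = 0.
Proof.
move=> free_f u0 k; apply: (can_inj (@conjCK _)); rewrite [RHS]rmorph0.
apply: (free_f (fun k => Num.conj (u k))); apply: meval_eq0 => v.
have := congr1 Num.conj (u0 (\col_j v j)); rewrite rmorph0 rmorph_sum => <-.
rewrite raddf_sum; apply: eq_bigr => l _ /=; rewrite mevalZ rmorphM /= conjCK.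
by congr (_ * _); apply: meval_eq => j; rewrite mxE.
Qed.

Definition invariant_poly Gamma p : Prop :=
  forall g z, g \in Gamma -> peval p (g *m z) = peval p z.

Lemma kernel_map_invariant Gamma (I : finType) (f : I -> mpoly n C) :
  finite_unitary_subgroup Gamma -> lin_indep f ->
  (forall z w, kernel_map f z w = Phi_kernel Gamma z w) ->
  forall k, invariant_poly Gamma (f k).
Proof.
move=> gpGamma free_f fE k g z g_in; apply/eqP; rewrite -subr_eq0; apply/eqP; move: k.
apply: (lin_indep_separates free_f (u := fun k => peval (f k) (g *m z) - peval (f k) z)) => w.
under eq_bigr do rewrite mulrBl.
by rewrite sumrB -!/(kernel_map f _ w) !fE Phi_kernel_inv // subrr.
Qed.

Lemma kernel_map_at0 Gamma (I : finType) (f : I -> mpoly n C) :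
  lin_indep f -> (forall z w, kernel_map f z w = Phi_kernel Gamma z w) ->
  forall k, peval (f k) 0 = 0.
Proof.
move=> free_f fE; apply: (lin_indep_separates free_f (u := fun k => peval (f k) 0)) => w.
by rewrite -/(kernel_map f 0 w) fE Phi_kernel0.
Qed.

Lemma herm_scaled_delta (i : 'I_n) z :
  z i 0 != 0 -> herm z ((Num.conj (z i 0))^-1 *: delta_mx i 0) = 1.
Proof.
move=> zi; rewrite /herm (bigD1 i) //= big1 => [|j ne_ji].
  by rewrite !mxE !eqxx /= mulr1 fmorphV /= conjCK mulfV // addr0.
by rewrite !mxE (negbTE ne_ji) /= mulr0 rmorph0 mulr0.
Qed.

(** Since the factor of Phi at the identity vanishes, f(z) conj f(w) = 1 as soon
    as <z, w> = 1.  If f had a single component p, then taking for w a multiple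
    of a basis vector e_i shows that p(z) depends only on z_i when z_i != 0.
    With two coordinates at hand, p is constant where z_0 != 0, hence constant,
    and then zero as p(0) = 0, a contradiction. *)
Lemma kernel_map_card_gt1 Gamma (d : nat) (f : 'I_d -> mpoly n C) :
  (2 <= n)%N -> finite_unitary_subgroup Gamma ->
  (forall z w, kernel_map f z w = Phi_kernel Gamma z w) ->
  (forall k, peval (f k) 0 = 0) -> (1 < d)%N.
Proof.
move=> n_gt1 gpGamma fE f0.
pose i0 : 'I_n := Ordinal (ltnW n_gt1); pose i1 : 'I_n := Ordinal n_gt1.
have f1 z w : herm z w = 1 -> kernel_map f z w = 1 by move=> zw; rewrite fE Phi_kernel_eq1.
have pt1 (i : 'I_n) : herm (delta_mx i 0 : 'cV[C]_n) (delta_mx i 0) = 1 by exact: delta_sphere.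
case: d f fE f0 f1 => [|[|d]] // f fE f0 f1.
  by have := f1 _ _ (pt1 i0); rewrite /kernel_map big_ord0 => /eqP; rewrite eq_sym oner_eq0.
exfalso; pose p := f ord0.
have {}f1 z w : herm z w = 1 -> peval p z * Num.conj (peval p w) = 1.
  by move/f1; rewrite /kernel_map big_ord1.
have same_coord i z z' : z i 0 != 0 -> z i 0 = z' i 0 -> peval p z = peval p z'.
  move=> zi eq_zi; pose w : 'cV[C]_n := (Num.conj (z i 0))^-1 *: delta_mx i 0.
  have zw : peval p z * Num.conj (peval p w) = 1 by apply/f1/herm_scaled_delta.
  have zw' : peval p z' * Num.conj (peval p w) = 1.
    by apply: f1; rewrite /w eq_zi; apply: herm_scaled_delta; rewrite -eq_zi.
  apply: (@mulIf _ (Num.conj (peval p w))); last by rewrite zw zw'.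
  by apply/eqP => c0; have /eqP := zw; rewrite c0 mulr0 eq_sym oner_eq0.
have ne10 : (i0 == i1) = false by [].
have const z : z i0 0 != 0 -> peval p z = peval p (delta_mx i1 0).
  (* z' has the i0-th coordinate of z and the i1-th coordinate of e_i1. *)
  move=> z0; pose z' : 'cV[C]_n := z i0 0 *: delta_mx i0 0 + delta_mx i1 0.
  rewrite (same_coord i0 z z') //; last by rewrite !mxE !eqxx ne10 /= mulr1 addr0.
  have z'1 : z' i1 0 = 1 by rewrite !mxE eqxx eq_sym ne10 /= mulr0 add0r.
  by apply: (same_coord i1); rewrite z'1 ?oner_eq0 // mxE !eqxx.
have : mpolyX C (mnm1 i0) * (p - mpolyC n (peval p (delta_mx i1 0))) = 0.
  apply: meval_eq0 => v; rewrite mevalM mevalXU mevalB mevalC.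
  have [->|v0] := eqVneq (v i0) 0; first by rewrite mul0r.
  have <- : peval p (\col_j v j) = meval v p by apply: meval_eq => j; rewrite mxE.
  by rewrite const ?mxE // subrr mulr0.
move/eqP; rewrite mulf_eq0 => /orP[|]; first by rewrite -msize_poly_eq0 msizeX.
rewrite subr_eq0 => /eqP pE; have c0 : peval p (delta_mx i1 0) = 0.
  by rewrite -(f0 ord0) -/p [in RHS]pE [RHS]mevalC.
by have := f1 _ _ (pt1 i1); rewrite c0 mul0r => /eqP; rewrite eq_sym oner_eq0.
Qed.

End KernelMap.

(** * Tensor products of sphere maps *)

Section Tensor.
Variables (R : realType) (n : nat).
Local Notation C := R[i].
Implicit Types (Gamma : {fset 'M[C]_n}) (z w : 'cV[C]_n) (p q : mpoly n C).

(** Independence is that of the components as polynomials: it is what the degree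
    argument preserves, and [eq0_on_sphere] turns it into minimality of the
    embedding dimension. *)
Definition sphere_family Gamma (I : finType) (g : I -> mpoly n C) : Prop :=
  [/\ lin_indep g, forall z, sphere z -> kernel_map g z z = 1
    & forall k, invariant_poly Gamma (g k)].

Lemma sphere_family_reindex Gamma (I J : finType) (g : I -> mpoly n C) (s : J -> I) :
  bijective s -> sphere_family Gamma g -> sphere_family Gamma (g \o s).
Proof.
move=> bij_s [free_g g1 inv_g]; split=> [|z Sz|k]; last exact: inv_g.
  exact: lin_indep_reindex.
by rewrite -(g1 z Sz) /kernel_map [RHS](reindex s) //; exact: onW_bij.
Qed.

Lemma sphere_family_card Gamma (I : finType) (g : I -> mpoly n C) (m : nat) :
  #|I| = m -> sphere_family Gamma g ->
  exists g' : 'I_m -> mpoly n C, sphere_family Gamma g'.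
Proof.
move=> <- fam_g; exists (g \o enum_val); exact: sphere_family_reindex.
Qed.

(** A nonzero combination of polynomials vanishing at 0 is not constant. *)
Lemma msize_comb (I : finType) (f : I -> mpoly n C) (b : I -> C) :
  (forall k, peval (f k) 0 = 0) -> \sum_k b k *: f k != 0 ->
  (1 < mmeasure mdeg (\sum_k b k *: f k)%R)%N.
Proof.
move=> f0 nz; rewrite ltnNge; apply: contra nz => /msize1_polyC qE.
have q0 : peval (\sum_k b k *: f k) 0 = 0.
  by rewrite /peval raddf_sum big1 // => k _ /=; rewrite mevalZ [meval _ _]f0 mulr0.
by rewrite qE; rewrite qE /peval mevalC in q0; rewrite q0 mpolyC0.
Qed.

(** A nonzero combination of the products h f_k has larger degree than h, hence
    cannot be compensated by the g_i. *)
Lemma top_degree_tensor (I K : finType) (g : I -> mpoly n C) (f : K -> mpoly n C)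
    (h : I) (a : I -> C) (b : K -> C) :
  lin_indep g -> lin_indep f -> (forall k, peval (f k) 0 = 0) ->
  (forall i, mmeasure mdeg (g i) <= mmeasure mdeg (g h))%N ->
  \sum_i a i *: g i + \sum_k b k *: (g h * f k) = 0 ->
  (forall i, a i = 0) /\ (forall k, b k = 0).
Proof.
move=> free_g free_f f0 max_h.
have -> : \sum_k b k *: (g h * f k) = g h * \sum_k b k *: f k.
  by rewrite mulr_sumr; apply: eq_bigr => k _; rewrite scalerAr.
have h_neq0 : g h != 0.
  apply/eqP => h0; have := free_g (fun i => (i == h)%:R); rewrite (bigD1 h) //= h0.
  rewrite scaler0 add0r big1 => [/(_ erefl h)/eqP|i /negbTE->].
    by rewrite eqxx oner_eq0.
  by rewrite scale0r.
have [q0|q_neq0] := eqVneq (\sum_k b k *: f k) 0.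
  by rewrite q0 mulr0 addr0 => /free_g a0; split=> //; exact: free_f.
have q_size := msize_comb f0 q_neq0.
move/eqP; rewrite addr_eq0 => /eqP sum_a; exfalso.
have : (mmeasure mdeg (\sum_i a i *: g i)%R <= mmeasure mdeg (g h))%N.
  apply: leq_trans (msize_sum _ _ _) _; apply/bigmax_leqP => i _.
  exact: leq_trans (msizeZ_le _ _) (max_h i).
rewrite sum_a msizeN msizeM //.
have : (0 < mmeasure mdeg (g h))%N by rewrite lt0n msize_poly_eq0.
move: q_size; move: (mmeasure _ _) => u; move: (mmeasure _ _) => v.
lia.
Qed.

Lemma max_degree_component (m : nat) (g : 'I_m.+1 -> mpoly n C) :
  exists h, forall i, (mmeasure mdeg (g i) <= mmeasure mdeg (g h))%N.
Proof.
by case: (arg_maxnP (fun i => mmeasure mdeg (g i)) (P := predT) (i0 := ord0)) => // h _ h_max;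
   exists h => i; apply: h_max.
Qed.

Lemma invariant_polyM Gamma p q :
  invariant_poly Gamma p -> invariant_poly Gamma q -> invariant_poly Gamma (p * q).
Proof. by move=> ip iq g z g_in; rewrite /peval !mevalM [X in X * _]ip // [X in _ * X]iq. Qed.

Lemma invariant_polyZ Gamma c p : invariant_poly Gamma p -> invariant_poly Gamma (c *: p).
Proof. by move=> ip g z g_in; rewrite /peval !mevalZ [X in _ * X]ip. Qed.

Lemma full_tensor Gamma (m d : nat) (g : 'I_m.+1 -> mpoly n C) (f : 'I_d -> mpoly n C) :
  (forall k, peval (f k) 0 = 0) -> sphere_family Gamma f -> sphere_family Gamma g ->
  exists g' : 'I_(m + d) -> mpoly n C, sphere_family Gamma g'.
Proof.
move=> f0 [free_f f1 inv_f] [free_g g1 inv_g].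
have [h h_max] := max_degree_component g.
pose t (x : {i | i != h} + 'I_d) : mpoly n C :=
  match x with inl i => g (val i) | inr k => g h * f k end.
apply: (@sphere_family_card _ _ t).
  by rewrite card_sum card_sig card_ord cardC1 card_ord.
split=> [a|z Sz|[i|k]] /=; last 2 first.
- exact: inv_g.
- exact: invariant_polyM.
- rewrite big_sumType /= => sum0.
  pose b i := oapp (fun i => a (inl i)) 0 (insub i).
  have bval (i : {i | i != h}) : b (val i) = a (inl i) by rewrite /b valK.
  have : \sum_i b i *: g i + \sum_k a (inr k) *: (g h * f k) = 0.
    rewrite -[RHS]sum0; congr (_ + _); rewrite (bigD1 h) //= {1}/b insubF ?eqxx //=.
    by rewrite scale0r add0r big_sig; apply: eq_bigr => i _; rewrite bval.
  case/(top_degree_tensor free_g free_f f0 h_max) => b0 a0 [i|k]; last exact: a0.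
  by rewrite -bval.
- rewrite /kernel_map big_sumType /= -(g1 z Sz) /kernel_map (bigD1 h) //= addrC.
  congr (_ + _); last by rewrite [RHS]big_sig.
  rewrite -[RHS]mulr1 -(f1 z Sz) /kernel_map mulr_sumr; apply: eq_bigr => k _.
  by rewrite /peval mevalM rmorphM /= mulrACA.
Qed.

(** The factors 3/5 and 4/5 are the legs of a Pythagorean triple, so the squared
    norm of the map is unchanged on the sphere. *)
Lemma partial_tensor Gamma (m d : nat) (g : 'I_m.+1 -> mpoly n C) (f : 'I_d -> mpoly n C) :
  (forall k, peval (f k) 0 = 0) -> sphere_family Gamma f -> sphere_family Gamma g ->
  exists g' : 'I_(m.+1 + d) -> mpoly n C, sphere_family Gamma g'.
Proof.
move=> f0 [free_f f1 inv_f] [free_g g1 inv_g].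
have [h h_max] := max_degree_component g.
pose s : C := 3%:R / 5%:R; pose c : C := 4%:R / 5%:R.
have s_conj : Num.conj s = s by rewrite rmorphM fmorphV !rmorph_nat.
have c_conj : Num.conj c = c by rewrite rmorphM fmorphV !rmorph_nat.
have sc1 : s * s + c * c = 1 by rewrite /s /c; field.
have s_neq0 : s != 0 by rewrite mulf_neq0 ?invr_eq0 ?pnatr_eq0.
have c_neq0 : c != 0 by rewrite mulf_neq0 ?invr_eq0 ?pnatr_eq0.
clearbody s c.
pose e i := if i == h then s else 1.
pose t (x : 'I_m.+1 + 'I_d) : mpoly n C :=
  match x with inl i => e i *: g i | inr k => c *: (g h * f k) end.
apply: (@sphere_family_card _ _ t); first by rewrite card_sum !card_ord.
split=> [a|z Sz|[i|k]] /=; last 2 first.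
- exact/invariant_polyZ/inv_g.
- exact/invariant_polyZ/invariant_polyM.
- rewrite big_sumType /= => sum0.
  have : \sum_i (a (inl i) * e i) *: g i + \sum_k (a (inr k) * c) *: (g h * f k) = 0.
    by rewrite -[RHS]sum0; congr (_ + _); apply: eq_bigr => i _; rewrite scalerA.
  case/(top_degree_tensor free_g free_f f0 h_max) => a0 b0 [i|k].
    have /eqP := a0 i; rewrite mulf_eq0 /e; case: (i == h).
      by rewrite (negbTE s_neq0) orbF => /eqP.
    by rewrite oner_eq0 orbF => /eqP.
  by have /eqP := b0 k; rewrite mulf_eq0 (negbTE c_neq0) orbF => /eqP.
- rewrite /kernel_map big_sumType /= -(g1 z Sz) /kernel_map.
  have -> : \sum_k peval (c *: (g h * f k)) z * Num.conj (peval (c *: (g h * f k)) z) =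
      c * c * (peval (g h) z * Num.conj (peval (g h) z)).
    rewrite -[RHS]mulr1 -(f1 z Sz) /kernel_map mulr_sumr; apply: eq_bigr => k _.
    by rewrite /peval mevalZ mevalM !rmorphM /= c_conj; ring.
  rewrite (bigD1 h) //= [RHS](bigD1 h) //= addrAC; congr (_ + _).
    by rewrite /peval mevalZ rmorphM /= /e eqxx s_conj mulrACA -mulrDl sc1 mul1r.
  by apply: eq_bigr => i /negbTE ne_ih; rewrite /e ne_ih scale1r.
Qed.

Lemma iterated_tensor Gamma (d a b : nat) (f : 'I_d.+1 -> mpoly n C) :
  (forall k, peval (f k) 0 = 0) -> sphere_family Gamma f ->
  exists g : 'I_(d.+1 + a * d + b * d.+1) -> mpoly n C, sphere_family Gamma g.
Proof.
move=> f0 fam_f; elim: b => [|b [g fam_g]].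
  rewrite mul0n addn0; elim: a => [|a [g fam_g]]; first by rewrite addn0; exists f.
  have [g' fam_g'] := full_tensor (m := (d + a * d)%N) f0 fam_f fam_g.
  by apply: sphere_family_card fam_g'; rewrite card_ord; lia.
have [g' fam_g'] := partial_tensor (m := (d + a * d + b * d.+1)%N) f0 fam_f fam_g.
by apply: sphere_family_card fam_g'; rewrite card_ord; lia.
Qed.

(** Dividing N - d = q (d - 1) + r, the bound on N gives q >= d - 2 >= r, and
    N - d = (q - r) (d - 1) + r d. *)
Lemma numerical_semigroup (d N : nat) :
  (1 < d)%N -> (d ^ 2 + 2 <= N + 2 * d)%N ->
  exists a b, N = (d + a * d.-1 + b * d)%N.
Proof.
case: d => [|[|d]] // _ le_N; rewrite /=.
pose M := (N - d.+2)%N; have NE : N = (d.+2 + M)%N by rewrite /M; nia.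
exists (M %/ d.+1 - M %% d.+1)%N, (M %% d.+1)%N.
have le_rq : (M %% d.+1 <= M %/ d.+1)%N.
  have lt_r := ltn_pmod M (ltn0Sn d); have := divn_eq M d.+1; nia.
rewrite {1}NE {1}(divn_eq M d.+1); nia.
Qed.

End Tensor.

(** * Polynomials are smooth CR functions *)

Lemma linear_derive (R : realType) (V : normedModType R) (L : {linear V -> R^o}) (x v : V) :
  continuous L -> 'D_v (L : V -> R) x = L v.
Proof.
by move=> cL; rewrite deriveE ?diff_lin //; exact: linear_differentiable.
Qed.

Lemma complex_ReM (R : realType) (x y : R[i]) :
  complex.Re (x * y) = complex.Re x * complex.Re y - complex.Im x * complex.Im y.
Proof. by case: x => a b; case: y. Qed.

Lemma complex_ImM (R : realType) (x y : R[i]) :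
  complex.Im (x * y) = complex.Re x * complex.Im y + complex.Im x * complex.Re y.
Proof. by case: x => a b; case: y. Qed.

Section PolynomialFunctions.
Variables (R : realType) (n : nat).
Local Notation C := R[i].
Local Notation V := ('cV[R]_n * 'cV[R]_n)%type.
Implicit Types (f g : V -> R) (F G : V -> C) (x v : V).

Definition re_coord (j : 'I_n) x : R^o := x.1 j 0.
Definition im_coord (j : 'I_n) x : R^o := x.2 j 0.

Fact re_coord_linear j : linear (re_coord j).
Proof. by move=> c x y; rewrite /re_coord !mxE. Qed.
Fact im_coord_linear j : linear (im_coord j).
Proof. by move=> c x y; rewrite /im_coord !mxE. Qed.
HB.instance Definition _ j :=
  GRing.isLinear.Build R V R^o *:%R (re_coord j) (re_coord_linear j).
HB.instance Definition _ j :=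
  GRing.isLinear.Build R V R^o *:%R (im_coord j) (im_coord_linear j).

Lemma re_coord_continuous j : continuous (re_coord j).
Proof.
move=> x; apply: (@continuous_comp V _ R (fun x : V => x.1) (fun M : 'cV[R]_n => M j 0)).
  exact: cvg_fst.
exact: coord_continuous.
Qed.

Lemma im_coord_continuous j : continuous (im_coord j).
Proof.
move=> x; apply: (@continuous_comp V _ R (fun x : V => x.2) (fun M : 'cV[R]_n => M j 0)).
  exact: cvg_snd.
exact: coord_continuous.
Qed.

(** A class of functions that is stable under directional derivatives; this
    stability is what makes induction on the order of differentiability work. *)
Inductive real_poly_fun : (V -> R) -> Prop :=
| RealPolyCst c : real_poly_fun (cst c)
| RealPolyRe j : real_poly_fun (re_coord j)
| RealPolyIm j : real_poly_fun (im_coord j)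
| RealPolyAdd f g : real_poly_fun f -> real_poly_fun g -> real_poly_fun (f + g)
| RealPolyMul f g : real_poly_fun f -> real_poly_fun g -> real_poly_fun (f * g).

Lemma real_poly_fun_differentiable f x : real_poly_fun f -> differentiable f x.
Proof.
elim=> [c|j|j|{}f g _ df _ dg|{}f g _ df _ dg].
- exact: differentiable_cst.
- exact: linear_differentiable (@re_coord_continuous j).
- exact: linear_differentiable (@im_coord_continuous j).
- exact: differentiableD.
- exact: differentiableM.
Qed.

Lemma real_poly_fun_derive f v : real_poly_fun f -> real_poly_fun ('D_v f).
Proof.
elim=> [c|j|j|{}f g pf df pg dg|{}f g pf df pg dg].
- rewrite (_ : 'D_v _ = cst 0); first exact: RealPolyCst.
  by apply/funext => x; exact: derive_cst.
- rewrite (_ : 'D_v _ = cst (re_coord j v)); first exact: RealPolyCst.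
  by apply/funext => x; apply: linear_derive; exact: re_coord_continuous.
- rewrite (_ : 'D_v _ = cst (im_coord j v)); first exact: RealPolyCst.
  by apply/funext => x; apply: linear_derive; exact: im_coord_continuous.
- rewrite (_ : 'D_v _ = 'D_v f + 'D_v g); first exact: RealPolyAdd.
  by apply/funext => x; apply: deriveD; exact/diff_derivable/real_poly_fun_differentiable.
- rewrite (_ : 'D_v _ = f * 'D_v g + g * 'D_v f).
    by apply: RealPolyAdd; apply: RealPolyMul.
  by apply/funext => x; apply: deriveM; exact/diff_derivable/real_poly_fun_differentiable.
Qed.

Lemma real_poly_fun_smooth (U : set V) f : real_poly_fun f -> smooth_on U f.
Proof.
move=> pf k; elim: k => [|k IHk] in f pf *.
  by move=> x _; exact/differentiable_continuous/real_poly_fun_differentiable.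
split=> [x _|v]; first exact: real_poly_fun_differentiable.
exact/IHk/real_poly_fun_derive.
Qed.

(** Polynomials in z satisfy the Cauchy-Riemann equations at every point and in
    every direction, so that tangency never has to be tracked. *)
Definition holo_poly_fun F : Prop :=
  [/\ real_poly_fun (fun x => complex.Re (F x)), real_poly_fun (fun x => complex.Im (F x))
    & forall x (v : 'cV[C]_n),
        dderiv F x (realify ('i%C *: v)) = 'i%C * dderiv F x (realify v)].

Lemma dderivD F G x v : holo_poly_fun F -> holo_poly_fun G ->
  dderiv (fun y => F y + G y) x v = dderiv F x v + dderiv G x v.
Proof.
move=> [rF iF _] [rG iG _]; rewrite /dderiv.
have -> : (fun y => complex.Re (F y + G y)) =
    (fun y => complex.Re (F y)) + (fun y => complex.Re (G y)).
  by apply/funext => y; rewrite raddfD.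
have -> : (fun y => complex.Im (F y + G y)) =
    (fun y => complex.Im (F y)) + (fun y => complex.Im (G y)).
  by apply/funext => y; rewrite raddfD.
by rewrite !deriveD //; exact/diff_derivable/real_poly_fun_differentiable.
Qed.

Lemma dderivM F G x v : holo_poly_fun F -> holo_poly_fun G ->
  dderiv (fun y => F y * G y) x v = F x * dderiv G x v + G x * dderiv F x v.
Proof.
move=> [rF iF _] [rG iG _]; rewrite /dderiv.
have -> : (fun y => complex.Re (F y * G y)) =
    (fun y => complex.Re (F y)) * (fun y => complex.Re (G y)) -
    (fun y => complex.Im (F y)) * (fun y => complex.Im (G y)).
  by apply/funext => y; exact: complex_ReM.
have -> : (fun y => complex.Im (F y * G y)) =
    (fun y => complex.Re (F y)) * (fun y => complex.Im (G y)) +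
    (fun y => complex.Im (F y)) * (fun y => complex.Re (G y)).
  by apply/funext => y; exact: complex_ImM.
have dd f : real_poly_fun f -> derivable f x v.
  by move=> pf; exact/diff_derivable/real_poly_fun_differentiable.
rewrite deriveB ?deriveD ?deriveM; try by apply: dd => //; exact: RealPolyMul.
case: (F x) => a b; case: (G x) => c d; apply/eqP; rewrite eq_complex /=.
by apply/andP; split; apply/eqP; rewrite /GRing.scale /=; ring.
Qed.

Lemma holo_poly_fun_cst c : holo_poly_fun (fun=> c).
Proof.
split=> [||x v]; try exact: RealPolyCst.
by rewrite /dderiv !derive_cst; apply/eqP; rewrite eq_complex /= !mul0r !mul1r subrr addr0
  eqxx.
Qed.

Lemma holo_poly_fun_coord (j : 'I_n) : holo_poly_fun (fun x => x.1 j 0 +i* x.2 j 0).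
Proof.
split=> [||x v]; [exact: RealPolyRe|exact: RealPolyIm|].
rewrite /dderiv /= !(linear_derive _ _ (@re_coord_continuous j)).
rewrite !(linear_derive _ _ (@im_coord_continuous j)) /= /re_coord /im_coord /realify /= !mxE.
by case: (v j 0) => a b; apply/eqP; rewrite eq_complex /= !eqxx.
Qed.

Lemma holo_poly_funD F G : holo_poly_fun F -> holo_poly_fun G ->
  holo_poly_fun (fun x => F x + G x).
Proof.
move=> hF hG; have [rF iF dF] := hF; have [rG iG dG] := hG; split=> [||x v].
- rewrite (_ : (fun _ => _) = (fun y => complex.Re (F y)) + (fun y => complex.Re (G y))).
    exact: RealPolyAdd.
  by apply/funext => y; rewrite raddfD.
- rewrite (_ : (fun _ => _) = (fun y => complex.Im (F y)) + (fun y => complex.Im (G y))).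
    exact: RealPolyAdd.
  by apply/funext => y; rewrite raddfD.
- by rewrite !dderivD // dF dG mulrDr.
Qed.

Lemma holo_poly_funM F G : holo_poly_fun F -> holo_poly_fun G ->
  holo_poly_fun (fun x => F x * G x).
Proof.
move=> hF hG; have [rF iF dF] := hF; have [rG iG dG] := hG; split=> [||x v].
- rewrite (_ : (fun _ => _) = (fun y => complex.Re (F y)) * (fun y => complex.Re (G y)) +
    cst (-1) * ((fun y => complex.Im (F y)) * (fun y => complex.Im (G y)))).
    by apply: RealPolyAdd; apply: RealPolyMul => //; [exact: RealPolyCst|exact: RealPolyMul].
  by apply/funext => y; rewrite complex_ReM -[X in _ + X = _]mulN1r.
- rewrite (_ : (fun _ => _) = (fun y => complex.Re (F y)) * (fun y => complex.Im (G y)) +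
    (fun y => complex.Im (F y)) * (fun y => complex.Re (G y))).
    by apply: RealPolyAdd; apply: RealPolyMul.
  by apply/funext => y; exact: complex_ImM.
- by rewrite !dderivM // dF dG; ring.
Qed.

Lemma holo_poly_fun_meval (p : mpoly n C) :
  holo_poly_fun (fun x => meval (fun j => x.1 j 0 +i* x.2 j 0) p).
Proof.
rewrite (_ : (fun _ => _) = fun x => \sum_(m <- msupp p)
    mcoeff m p * \prod_(j < n) (x.1 j 0 +i* x.2 j 0) ^+ m j); last first.
  by apply/funext => x; rewrite mevalE.
elim: (msupp p) => [|m s IHs].
  rewrite (_ : (fun _ => _) = fun=> 0); first exact: holo_poly_fun_cst.
  by apply/funext => x; rewrite big_nil.
rewrite (_ : (fun _ => _) = fun x => mcoeff m p * \prod_(j < n) (x.1 j 0 +i* x.2 j 0) ^+ m j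
   + \sum_(m <- s) mcoeff m p * \prod_(j < n) (x.1 j 0 +i* x.2 j 0) ^+ m j); last first.
  by apply/funext => x; rewrite big_cons.
apply: holo_poly_funD IHs; apply: holo_poly_funM; first exact: holo_poly_fun_cst.
elim: (index_enum _) => [|j r IHr].
  rewrite (_ : (fun _ => _) = fun=> 1); first exact: holo_poly_fun_cst.
  by apply/funext => x; rewrite big_nil.
rewrite (_ : (fun _ => _) = fun x => (x.1 j 0 +i* x.2 j 0) ^+ m j *
   \prod_(j <- r) (x.1 j 0 +i* x.2 j 0) ^+ m j); last first.
  by apply/funext => x; rewrite big_cons.
apply: holo_poly_funM IHr; elim: (m j) => [|k IHk].
  rewrite (_ : (fun _ => _) = fun=> 1); first exact: holo_poly_fun_cst.
  by apply/funext => x; rewrite expr0.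
rewrite (_ : (fun _ => _) = fun x => (x.1 j 0 +i* x.2 j 0) *
   (x.1 j 0 +i* x.2 j 0) ^+ k); last by apply/funext => x; rewrite exprS.
by apply: holo_poly_funM => //; exact: holo_poly_fun_coord.
Qed.

Lemma smooth_CR_peval (p : mpoly n C) : smooth_CR_function (peval p).
Proof.
exists setT, (fun x => meval (fun j => x.1 j 0 +i* x.2 j 0) p).
have [rp ip dp] := holo_poly_fun_meval p; split=> //.
- by split=> //; exact: openT.
- by split; exact: real_poly_fun_smooth.
- move=> z _; rewrite /peval; apply: meval_eq => j; rewrite /realify /= !mxE.
  by case: (z j 0).
Qed.

End PolynomialFunctions.

(** * Existence of the maps *)

(** Two components that are constant on the sphere satisfy a nontrivial linear
    relation there. *)
Lemma sphere_family_nonconstant (R : realType) (n N : nat) (Gamma : {fset 'M[R[i]]_n})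
    (g : 'I_N -> mpoly n R[i]) :
  (0 < n)%N -> (1 < N)%N -> sphere_family Gamma g ->
  nonconstant_on_sphere (fun z => \col_k peval (g k) z).
Proof.
move=> n_gt0 N_gt1 [free_g _ _]; apply: contrapT => cst_f.
pose z0 : 'cV[R[i]]_n := delta_mx (Ordinal n_gt0) 0.
have Sz0 : sphere z0 by exact: delta_sphere.
have const k z : sphere z -> peval (g k) z = peval (g k) z0.
  move=> Sz; apply: contrapT => ne; apply: cst_f; exists z, z0; split=> // /colP/(_ k).
  by rewrite !mxE.
pose k0 : 'I_N := Ordinal (ltnW N_gt1); pose k1 : 'I_N := Ordinal N_gt1.
pose c k := peval (g k) z0.
have rel (x y : R[i]) : x * c k0 + y * c k1 = 0 -> x = 0 /\ y = 0.
  move=> xy0; pose a k := if k == k0 then x else if k == k1 then y else 0.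
  have a0 : forall k, a k = 0.
    apply: free_g; apply: (@eq0_on_sphere R n) => // z Sz.
    rewrite /peval raddf_sum (bigD1 k0) //= (bigD1 k1) //= big1 => [|k /andP[ne0 ne1]].
      by rewrite addr0 !mevalZ /a !eqxx /= [meval _ _](const k0) // [X in y * X](const k1).
    by rewrite mevalZ /a (negbTE ne0) (negbTE ne1) mul0r.
  by split; [have := a0 k0 | have := a0 k1].
have [_ /eqP] : c k1 = 0 /\ - c k0 = 0 by apply: rel; ring.
rewrite oppr_eq0 => /eqP c0.
have [/eqP] : 1 = 0 :> R[i] /\ 0 = 0 :> R[i] by apply: rel; rewrite c0; ring.
by rewrite oner_eq0.
Qed.

Theorem theorem1 (R : realType) (n : nat) (Gamma : {fset 'M[R[i]]_n}) (N : nat) :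
  (2 <= n)%N -> admissible Gamma ->
  (NGamma Gamma)%:Z ^+ 2 - 2 * (NGamma Gamma)%:Z + 2 <= N%:Z ->
  exists f : 'cV[R[i]]_n -> 'cV[R[i]]_N,
    [/\ smooth_CR_mapping f, invariant_under Gamma f,
        nonconstant_on_sphere f & minimal_embedding_dimension f].
Proof.
move=> n_gt1 admGamma le_N; have n_gt0 := ltnW n_gt1; have [gpGamma _] := admGamma.
have [f PhiE free_f] := Phi_lin_indep_sos (Phi_herm_sos n_gt0 admGamma).
have fE z w : kernel_map f z w = Phi_kernel Gamma z w by exact: kernel_mapE.
have f0 : forall k, peval (f k) 0 = 0 by exact: kernel_map_at0 fE.
have fam_f : sphere_family Gamma f.
  split=> // [z Sz|]; first by rewrite fE Phi_kernel_eq1.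
  exact: kernel_map_invariant.
have d_gt1 := kernel_map_card_gt1 n_gt1 gpGamma fE f0.
move: (NGamma Gamma) le_N f PhiE free_f fE f0 fam_f d_gt1 => d le_N f _ _ _ f0 fam_f d_gt1.
have le_dN : (d ^ 2 + 2 <= N + 2 * d)%N by move: le_N; lia.
have N_gt1 : (1 < N)%N by nia.
have [a [b NE]] := numerical_semigroup d_gt1 le_dN.
case: d d_gt1 f f0 fam_f NE {le_N le_dN} => // d _ f f0 fam_f NE.
have [g0 fam_g0] := iterated_tensor a b f0 fam_f.
have [g fam_g] : exists g : 'I_N -> mpoly n R[i], sphere_family Gamma g.
  by apply: sphere_family_card fam_g0; rewrite card_ord NE.
have [free_g g1 inv_g] := fam_g.
exists (fun z => \col_k peval (g k) z); split.
- split=> [z Sz|k].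
    rewrite /sphere /= /herm -(g1 z Sz).
    by apply: eq_bigr => k _; rewrite mxE.
  rewrite (_ : (fun _ => _) = peval (g k)); first exact: smooth_CR_peval.
  by apply/funext => z; rewrite mxE.
- by move=> h z h_in _; apply/colP => k; rewrite !mxE inv_g.
- exact: sphere_family_nonconstant fam_g.
- move=> a' sum0; apply: free_g; apply: eq0_on_sphere => // z Sz.
  rewrite /peval raddf_sum -[RHS](sum0 z Sz).
  by apply: eq_bigr => k _; rewrite /= mevalZ mxE.
Qed.
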